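(* Let $$G=\langle \theta_1,\theta_2,a,k \mid \theta_i^{-1}a\theta_i=a,\ \theta_i^{-1}k\theta_i=ka,\ i=1,2\rangle .$$ Then: (1) $G$ has a cubic isoperimetric function, i.e. an isoperimetric function equivalent to $n^3$; (2) $G$ has a linear isodiametric function, i.e. an isodiametric function equivalent to $n$; (3) $G$ has no simply connected asymptotic cones, i.e. for every ultrafilter $\omega$ on $\mathbb{N}$ and every increasing sequence $d=(d_n)$ of positive numbers with $\lim d_n=\infty$, the asymptotic cone $\mathrm{Con}_\omega(G,d)$ is not simply connected.
   Context: Isoperimetric and isodiametric functions. A function $f\colon\mathbb{N}\to\mathbb{N}$ is an isoperimetric (resp. isodiametric) function of a finite presentation $\langle X\mid R\rangle$ of a group $G$ if every word $w$ in $X$ (that is, a word over $X\cup X^{-1}$) which is equal to $1$ in $G$ is freely equal to a product of conjugates $\prod_{i=1}^m x_i^{-1}r_ix_i$, where $r_i$ or $r_i^{-1}$ is in $R$, $x_i\in(X\cup X^{-1})^*$, and $m\le f(|w|)$ (resp. $|x_i|\le f(|w|)$ for every $i$). Here $|\cdot|$ is word length. Two functions $f_1,f_2$ are equivalent if $f_2(n)\le Cf_1(Cn)+Cn$ and $f_1(n)\le Cf_2(Cn)+Cn$ for all $n$, for some constant $C$. Equivalent functions are not distinguished, and up to this equivalence isoperimetric (resp. isodiametric) functions do not depend on the choice of finite presentation of the group, so one may speak of isoperimetric and isodiametric functions of $G$. Asymptotic cones. Let $(X,\mathrm{dist})$ be a metric space, $o=(o_n)$ a sequence of points in $X$, $d=(d_n)$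 an increasing sequence of positive numbers with $\lim d_n=\infty$, and $\omega\colon P(\mathbb{N})\to\{0,1\}$ an ultrafilter. For a bounded sequence of real numbers $(a_n)$, $\lim_\omega(a_n)$ is the unique number $a$ such that for every $\epsilon>0$, $\omega(\{n\mid |a_n-a|<\epsilon\})=1$. The asymptotic cone $\mathrm{Con}_\omega(X,o,d)$ is the set of sequences $(x_i)_{i\in\mathbb{N}}\in X^{\mathbb{N}}$ with $\limsup \frac{\mathrm{dist}(o_i,x_i)}{d_i}<\infty$, where two sequences $(x_i)$ and $(y_i)$ are identified if $\lim_\omega\frac{\mathrm{dist}(x_i,y_i)}{d_i}=0$; the distance between $(x_i)$ and $(y_i)$ is $\lim_\omega\frac{\mathrm{dist}(x_i,y_i)}{d_i}$. For a finitely generated group $G$, the asymptotic cones of $G$ are the asymptotic cones of the Cayley graph of $G$ with respect to some finite generating set. They do not depend on the choice of $o$, so one takes $o=(1)$, the constant sequence at the identity, and writes $\mathrm{Con}_\omega(G,d)$. *)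

(* Defs.v *)
From HB Require Import structures.
From mathcomp Require Import all_boot all_order all_algebra generic_quotient.
From mathcomp Require Import all_classical all_reals all_analysis.

Set Implicit Arguments.
Unset Strict Implicit.
Unset Printing Implicit Defensive.

Import Order.TTheory GRing.Theory Num.Theory.
Import numFieldTopology.Exports numFieldNormedType.Exports.

Local Open Scope classical_set_scope.
Local Open Scope ring_scope.
Local Open Scope quotient_scope.

Section Words.
Variable X : Type.

(* The letter (x, false) is x and (x, true) is x^-1. *)
Definition word := seq (X * bool).

Definition letter (x : X) : word := [:: (x, false)].

Definition winv (w : word) : word := rev [seq (l.1, ~~ l.2) | l <- w].

Definition wconj (r x : word) : word := winv x ++ r ++ x.

Inductive weq (rels : word -> Prop) : word -> word -> Prop :=
| weq_refl u : weq rels u u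
| weq_sym u v : weq rels u v -> weq rels v u
| weq_trans u v w : weq rels u v -> weq rels v w -> weq rels u w
| weq_cancel u v l : weq rels (u ++ [:: l; (l.1, ~~ l.2)] ++ v) (u ++ v)
| weq_relator u v r : rels r -> weq rels (u ++ r ++ v) (u ++ v).

Definition freely_equal : word -> word -> Prop := weq (fun=> False).

End Words.

Arguments letter {X} x.

Definition wsubst (I X : Type) (S : I -> word X) (u : word I) : word X :=
  flatten [seq if l.2 then winv (S l.1) else S l.1 | l <- u].

Section Presentations.
Variables (X : finType) (rels : seq (word X)).

Definition group_eq : word X -> word X -> Prop := weq (fun r => r \in rels).

(* [ps] lists the pairs (r_i, x_i) of a product of conjugates x_i^-1 r_i x_i. *)
Definition conj_product (ps : seq (word X * word X)) : word X :=
  flatten [seq wconj p.1 p.2 | p <- ps].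

Definition relator_pairs (ps : seq (word X * word X)) : Prop :=
  forall p, p \in ps -> p.1 \in rels \/ winv p.1 \in rels.

Definition isoperimetric (f : nat -> nat) : Prop :=
  forall w, group_eq w [::] ->
  exists ps, [/\ relator_pairs ps, freely_equal w (conj_product ps) &
                 (size ps <= f (size w))%N].

Definition isodiametric (f : nat -> nat) : Prop :=
  forall w, group_eq w [::] ->
  exists ps, [/\ relator_pairs ps, freely_equal w (conj_product ps) &
                 forall p, p \in ps -> (size p.2 <= f (size w))%N].

Definition generates (I : Type) (S : I -> word X) : Prop :=
  forall w, exists u : word I, group_eq w (wsubst S u).

End Presentations.

Definition fequiv (f1 f2 : nat -> nat) : Prop :=
  exists C : nat, forall n,
    (f2 n <= C * f1 (C * n) + C * n)%N /\ (f1 n <= C * f2 (C * n) + C * n)%N.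

Record pseudodist (R : realType) (T : Type) := Pseudodist {
  pdist :> T -> T -> R;
  pdistxx : forall x, pdist x x = 0;
  pdistC : forall x y, pdist x y = pdist y x;
  pdist_triangle : forall y x z, pdist x z <= pdist x y + pdist y z
}.

Section MetricQuotient.
Variables (R : realType) (T : choiceType) (D : pseudodist R T).

Lemma pdist_ge0 x y : 0 <= D x y.
Proof.
have := pdist_triangle D y x x.
by rewrite pdistxx (pdistC D y x) -mulr2n pmulrn_lge0.
Qed.

Definition pdist0 : rel T := fun x y => D x y == 0.

Lemma pdist0_equiv : equiv_class_of pdist0.
Proof.
split=> [x|x y|y x z]; rewrite /pdist0 ?pdistxx//; first by rewrite pdistC.
move=> /eqP xy0 /eqP yz0; rewrite eq_le pdist_ge0 andbT.
by rewrite (le_trans (pdist_triangle D y x z))// xy0 yz0 addr0.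
Qed.

Canonical pdist0_equiv_rel := EquivRelPack pdist0_equiv.

Definition metric_quotient := {eq_quot pdist0}.
HB.instance Definition _ := Choice.on metric_quotient.

Definition mq_proj (x : T) : metric_quotient := \pi_{eq_quot pdist0} x.

Definition mq_dist (a b : metric_quotient) : R := D (repr a) (repr b).

Lemma pdist_repr_proj x : D x (repr (mq_proj x)) = 0.
Proof.
apply/eqP; have /esym := reprK (mq_proj x); rewrite {1}/mq_proj.
by move/eqquotP.
Qed.

Lemma pdist_eq x x' y : D x x' = 0 -> D x y = D x' y.
Proof.
move=> xx'; apply/eqP; rewrite eq_le.
have := pdist_triangle D x' x y; have := pdist_triangle D x x' y.
by rewrite (pdistC D x' x) xx' !add0r => -> ->.
Qed.

Lemma mq_distE x y : mq_dist (mq_proj x) (mq_proj y) = D x y.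
Proof.
rewrite /mq_dist -(pdist_eq _ (pdist_repr_proj x)) pdistC.
by rewrite -(pdist_eq _ (pdist_repr_proj y)) pdistC.
Qed.

Lemma mq_distxx a : mq_dist a a = 0. Proof. exact: pdistxx. Qed.

Lemma mq_dist_positivity a b : mq_dist a b = 0 -> a = b.
Proof.
move=> /eqP ab0; rewrite -[a]reprK -[b]reprK; apply/eqquotP.
exact: ab0.
Qed.

Lemma mq_distC a b : mq_dist a b = mq_dist b a. Proof. exact: pdistC. Qed.

Lemma mq_dist_triangle b a c : mq_dist a c <= mq_dist a b + mq_dist b c.
Proof. exact: pdist_triangle. Qed.

HB.instance Definition _ := @isMetric.Build R metric_quotient
  mq_dist mq_distxx mq_dist_positivity mq_distC mq_dist_triangle.

End MetricQuotient.

(* A unit interval is glued in from g to g * S i for each vertex g and each     *)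
(* index i.  Vertices are represented by words, so distinct words may represent *)
(* the same vertex; such points are at distance 0 and are identified below.     *)
Inductive cayley_point (R : realType) (X I : Type) :=
| CVertex of word X
| CEdge of word X & I & {t : R | 0 <= t <= 1}.

Arguments CVertex {R X I} g.
Arguments CEdge {R X I} g i t.

HB.instance Definition _ (R : realType) (X I : Type) :=
  gen_eqMixin (cayley_point R X I).
HB.instance Definition _ (R : realType) (X I : Type) :=
  gen_choiceMixin (cayley_point R X I).

Section CayleyGraph.
Variables (R : realType) (X : finType) (rels : seq (word X)).
Variables (I : finType) (S : I -> word X).
Local Notation point := (cayley_point R X I).

(* p and q are joined by a concatenation of segments of edges, of total length *)
(* l; the infimum of these lengths is the path metric.                         *)
Inductive cayley_chain : point -> point -> R -> Prop :=
| cchain_vertex g h : group_eq rels g h ->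
    cayley_chain (CVertex g) (CVertex h) 0
| cchain_edge g h i s t : group_eq rels g h ->
    cayley_chain (CEdge g i s) (CEdge h i t) `|val s - val t|
| cchain_source g i s : val s = 0 -> cayley_chain (CEdge g i s) (CVertex g) 0
| cchain_target g i s : val s = 1 ->
    cayley_chain (CEdge g i s) (CVertex (g ++ S i)) 0
| cchain_sym p q l : cayley_chain p q l -> cayley_chain q p l
| cchain_trans p q r l m : cayley_chain p q l -> cayley_chain q r m ->
    cayley_chain p r (l + m).

Definition cayley_dist (p q : point) : R := inf [set l | cayley_chain p q l].

Lemma cayley_chain_ge0 p q l : cayley_chain p q l -> 0 <= l.
Proof. by elim=> // *; rewrite addr_ge0. Qed.

Lemma cayley_chainxx p : cayley_chain p p 0.
Proof.
case: p => [g|g i t]; first by apply: cchain_vertex; apply: weq_refl.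
have := @cchain_edge g g i t t (weq_refl _ _).
by rewrite subrr normr0.
Qed.

Hypothesis genS : generates rels S.

Let join (p q : point) := exists l, cayley_chain p q l.

Let join_trans q p r : join p q -> join q r -> join p r.
Proof. by move=> [l pq] [m qr]; exists (l + m); apply: cchain_trans qr. Qed.

Let join_sym p q : join p q -> join q p.
Proof. by move=> [l pq]; exists l; apply: cchain_sym. Qed.

Let i0 : {t : R | 0 <= t <= 1}.
Proof. by exists 0; rewrite lexx ler01. Defined.

Let i1 : {t : R | 0 <= t <= 1}.
Proof. by exists 1; rewrite lexx ler01. Defined.

Let join_vertex g h : group_eq rels g h -> join (CVertex g) (CVertex h).
Proof. by move=> gh; exists 0; apply: cchain_vertex. Qed.

Let join_source g i t : join (CVertex g) (CEdge g i t).
Proof.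
apply: (join_trans (q := CEdge g i i0)).
  by apply: join_sym; exists 0; apply: cchain_source.
by exists `|val i0 - val t|; apply: cchain_edge; apply: weq_refl.
Qed.

Let join_step g i : join (CVertex g) (CVertex (g ++ S i)).
Proof.
apply: (join_trans (join_source g i i1)).
by exists 0; apply: cchain_target.
Qed.

Let weq_winvl (g : word X) : group_eq rels (winv g ++ g) [::].
Proof.
elim: g => [|[x b] g IH]; first exact: weq_refl.
rewrite /winv /= rev_cons -cats1 -catA /=.
apply: weq_trans IH.
by have := weq_cancel (fun r => r \in rels) (winv g) g (x, ~~ b);
  rewrite /= negbK.
Qed.

Let weq_catl (u : word X) v w :
  group_eq rels v w -> group_eq rels (u ++ v) (u ++ w).
Proof.
elim=> [v1|v1 w1 _|v1 w1 w2 _ + _|v1 w1 l|v1 w1 r rr].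
- exact: weq_refl.
- exact: weq_sym.
- exact: weq_trans.
- by rewrite !(catA u); apply: weq_cancel.
- by rewrite !(catA u); apply: weq_relator.
Qed.

Let join_wsubst g u : join (CVertex g) (CVertex (g ++ wsubst S u)).
Proof.
elim: u g => [|[i b] u IH] g.
  by rewrite cats0; apply: join_vertex; apply: weq_refl.
rewrite /wsubst /= -/(wsubst S u) catA; apply: (join_trans _ (IH _)).
case: b => /=; last exact: join_step.
apply: join_sym; apply: (join_trans (join_step _ i)); apply: join_vertex.
rewrite -catA -[X in group_eq _ _ X]cats0; apply: weq_catl; exact: weq_winvl.
Qed.

Let join1 g : join (CVertex [::]) (CVertex g).
Proof.
have [u gu] := genS g; apply: (join_trans (join_wsubst [::] u)).
by apply: join_vertex; apply: weq_sym.
Qed.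

Lemma cayley_chain_connected p q : exists l, cayley_chain p q l.
Proof.
suff h r : join (CVertex [::]) r.
  by apply: join_trans (h q); apply: join_sym.
by case: r => [g|g i t]; [|apply: join_trans (join_source g i t)].
Qed.

Let has_inf_chain p q : has_inf [set l | cayley_chain p q l].
Proof.
split; first by have [l pq] := cayley_chain_connected p q; exists l.
by exists 0 => l; apply: cayley_chain_ge0.
Qed.

Lemma cayley_distxx p : cayley_dist p p = 0.
Proof.
apply/eqP; rewrite eq_le; apply/andP; split.
  by apply: (ge_inf (proj2 (has_inf_chain p p))); apply: cayley_chainxx.
apply: lb_le_inf; first exact: (proj1 (has_inf_chain p p)).
by move=> l; apply: cayley_chain_ge0.
Qed.

Lemma cayley_distC p q : cayley_dist p q = cayley_dist q p.
Proof.
rewrite /cayley_dist; congr (inf _).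
by apply/seteqP; split=> l; apply: cchain_sym.
Qed.

Lemma cayley_dist_triangle q p r :
  cayley_dist p r <= cayley_dist p q + cayley_dist q r.
Proof.
apply/ler_addgt0Pl => e e0; have e20 : 0 < e / 2 by rewrite divr_gt0.
have [l pq le] := inf_adherent e20 (has_inf_chain p q).
have [m qr me] := inf_adherent e20 (has_inf_chain q r).
apply: (@le_trans _ _ (l + m)).
  apply: (ge_inf (proj2 (has_inf_chain p r))); exact: cchain_trans qr.
apply: le_trans (ltW (ltrD le me)) _.
by rewrite addrACA -splitr [leRHS]addrC.
Qed.

Definition cayley_pseudodist : pseudodist R point :=
  Pseudodist cayley_distxx cayley_distC cayley_dist_triangle.

Definition cayley_graph := metric_quotient cayley_pseudodist.
HB.instance Definition _ := Metric.on cayley_graph.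

Definition cayley_identity : cayley_graph :=
  mq_proj cayley_pseudodist (CVertex [::]).

End CayleyGraph.

Arguments cayley_graph R {X rels I S} genS.
Arguments cayley_identity R {X rels I S} genS.

(* [omega] is the family of sets of measure 1; it may be principal. *)
Section AsymptoticCone.
Variables (R : realType) (X : metricType R).
Variables (omega : set_system nat) (ultra : UltraFilter omega).
Variables (o : nat -> X) (d : nat -> R) (d_gt0 : forall n, 0 < d n).

Definition cone_seq := {x : nat -> X |
  (limn_esup (fun i => (mdist (o i) (x i) / d i)%:E) < +oo)%E}.
HB.instance Definition _ := gen_eqMixin cone_seq.
HB.instance Definition _ := gen_choiceMixin cone_seq.

Definition cone_dist (x y : cone_seq) : R :=
  lim (mdist (val x i) (val y i) / d i @[i --> omega]).

Let omega_proper : ProperFilter omega := @ultra_proper _ _ ultra.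
Local Existing Instance omega_proper.

Lemma ultra_bounded_cvg (a : nat -> R) (M : R) :
  (forall n, 0 <= a n <= M) -> cvg (a i @[i --> omega]).
Proof.
move=> aM; have FM : (a @ omega) `[0, M]%classic.
  apply: (@filterE _ omega) => n.
  by rewrite /= in_itv; exact: aM.
have [p [_ clp]] := @segment_compact R 0 M (a @ omega) _ FM.
apply/cvg_ex; exists p => B pB.
have [//|nB] := in_ultra_setVsetC (a @^-1` B) ultra.
by have [r [/= nBr Br]] := clp (~` B) B nB pB.
Qed.

Lemma cone_seq_bounded (x : cone_seq) :
  exists M, forall n, mdist (o n) (val x n) / d n <= M.
Proof.
have a0 n : 0 <= mdist (o n) (val x n) / d n.
  by rewrite divr_ge0 ?mdist_ge0 ?ltW.
have [_ [V [N _ NV] <-]] := ereal_inf_lt (valP x) => supV.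
have leV n : (N <= n)%N -> (((mdist (o n) (val x n) / d n)%:E <=
    ereal_sup [set (mdist (o i) (val x i) / d i)%:E | i in V])%E).
  by move=> Nn; apply: ereal_sup_ubound; exists n => //; exact: NV.
case: (ereal_sup _) supV leV => [c _ leV|//|_ leV]; last first.
  by have := leV N (leqnn N); rewrite leNgt ltNyr.
exists (`|c| + \sum_(i < N) mdist (o i) (val x i) / d i) => n.
have [Nn|nN] := leqP N n.
  have := leV n Nn; rewrite lee_fin => /le_trans; apply.
  by rewrite -[X in X <= _]addr0 lerD ?ler_norm ?sumr_ge0.
rewrite (bigD1 (Ordinal nN))//= addrCA lerDl addr_ge0//.
by rewrite sumr_ge0.
Qed.

Lemma cone_dist_cvg (x y : cone_seq) :
  cvg (mdist (val x i) (val y i) / d i @[i --> omega]).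
Proof.
have [M xM] := cone_seq_bounded x; have [N yN] := cone_seq_bounded y.
apply: (@ultra_bounded_cvg _ (M + N)) => n; apply/andP; split.
  by rewrite divr_ge0 ?mdist_ge0 ?ltW.
apply: le_trans (lerD (xM n) (yN n)); rewrite -mulrDl ler_pM2r ?invr_gt0//.
by rewrite (metric_sym (o n) (val x n)) metric_triangle.
Qed.

Lemma cone_distxx x : cone_dist x x = 0.
Proof.
rewrite /cone_dist; apply: cvg_lim => //.
under eq_fun do rewrite mdistxx mul0r.
exact: cvg_cst.
Qed.

Lemma cone_distC x y : cone_dist x y = cone_dist y x.
Proof. by rewrite /cone_dist; under eq_fun do rewrite metric_sym. Qed.

Lemma cone_dist_triangle y x z :
  cone_dist x z <= cone_dist x y + cone_dist y z.
Proof.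
rewrite /cone_dist -limD; [|exact: cone_dist_cvg..].
apply: ler_lim; first exact: cone_dist_cvg.
  by apply: is_cvgD; exact: cone_dist_cvg.
apply: filterE => n /=.
by rewrite fctE -mulrDl ler_pM2r ?invr_gt0// metric_triangle.
Qed.

Definition cone_pseudodist : pseudodist R cone_seq :=
  Pseudodist cone_distxx cone_distC cone_dist_triangle.

Definition asymptotic_cone := metric_quotient cone_pseudodist.
HB.instance Definition _ := Metric.on asymptotic_cone.

End AsymptoticCone.

Section SimplyConnected.
Variables (R : realType) (T : topologicalType).

Definition is_path (p : R -> T) : Prop := {within `[0, 1], continuous p}.

Definition path_connected : Prop :=
  forall x y : T, exists p, [/\ is_path p, p 0 = x & p 1 = y].

Definition null_homotopic (p : R -> T) : Prop :=
  exists H : R * R -> T,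
    {within `[0, 1] `*` `[0, 1], continuous H} /\
    forall t, t \in `[0, 1] ->
      [/\ H (0, t) = p t, H (1, t) = p 0, H (t, 0) = p 0 & H (t, 1) = p 0].

Definition simply_connected : Prop :=
  path_connected /\
  forall p, is_path p -> p 0 = p 1 -> null_homotopic p.

End SimplyConnected.

Inductive gen := theta1 | theta2 | gen_a | gen_k.

Definition gen_code (x : gen) : 'I_4 :=
  match x with
  | theta1 => inord 0 | theta2 => inord 1 | gen_a => inord 2 | gen_k => inord 3
  end.

Definition gen_decode (i : 'I_4) : gen := nth gen_k [:: theta1; theta2; gen_a] i.

Lemma gen_codeK : cancel gen_code gen_decode.
Proof. by case; rewrite /gen_decode /= inordK. Qed.

HB.instance Definition _ := Finite.copy gen (can_type gen_codeK).

(* A defining relation u = v is encoded by the relator u v^-1. *)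
Definition eq_relator (u v : word gen) : word gen := u ++ winv v.

Definition G_relators : seq (word gen) :=
  flatten [seq [:: eq_relator (wconj (letter gen_a) (letter t)) (letter gen_a);
                   eq_relator (wconj (letter gen_k) (letter t))
                            (letter gen_k ++ letter gen_a)]
          | t <- [:: theta1; theta2]].

(* Main.v *)
Require Import Defs.
From mathcomp Require Import all_boot all_order all_algebra.
From mathcomp Require Import all_classical all_reals all_analysis.
From mathcomp Require Import zify ring lra.
From Corelib Require Setoid Morphisms.

Set Implicit Arguments.
Unset Strict Implicit.
Unset Printing Implicit Defensive.

Import Order.TTheory GRing.Theory Num.Theory.
Import numFieldTopology.Exports numFieldNormedType.Exports.

Local Open Scope classical_set_scope.
Local Open Scope ring_scope.

(** Both letters theta_i act on the free group on [a] and [k] by the automorphism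
    fixing [a] and mapping [k] to [k a], so [G] is the semidirect product of this
    free group with the free group on theta1 and theta2.

    Filling functions.  In a word [w] equal to 1, all theta letters are moved to the
    right end.  Each of the at most [n] letters [k] has to pass at most [n] theta
    letters, and each passage costs linearly many relators since the word [k a^i]
    travelling along has length at most [n + 1].  This makes cubically many relators,
    and what is left is a word in [a] and [k] followed by a theta word, both freely
    trivial.  The conjugators stay linear if the relators used for a letter are
    placed in front of those used before ([fillable_normal_form]).

    Cones with unbounded scales.  The loop
    [k^n theta1^n theta2^-n k^-n theta2^n theta1^-n] is closed since
    [theta1^n theta2^-n] commutes with [k].  Over the tree of the free group on
    theta1 and theta2 it passes the vertex [theta1^n] twice, and this vertex separates
    the two halves of the loop.  Any filling of the loop by a grid therefore
    contains an interface ([interface_connect]), along which one can walk from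
    [k^n theta1^n] to [theta1^n] inside the fibre over that vertex.  In the fibre, a
    free group on [a] and [k], the starting point is [(k a^n)^n], which contains many
    runs of [a] longer than a small multiple of [n]; but multiplication by a
    word shorter than half that length destroys at most one such run
    ([long_runs_krun]).  Hence the interface has at least about [n] steps, while a
    null-homotopy in the cone yields, for almost all [n], fillings with a bounded number
    of cells ([cone_grid], [coarse_filling_false]).

    Cones with bounded scales, which occur for principal ultrafilters, look like the
    Cayley graph itself.  Collapsing the complement of an edge maps the graph to a
    circle, and if all loops were contractible then every closed path would wind zero
    times around every edge ([circle_grid]).  Then each closed path can be cancelled
    ([closed_word_trivial]), so [G] would be free on the generating family; but a
    homomorphism from [G] to Z^2 does not lift to the Heisenberg group
    ([G_not_free]). *)

(** * Words up to relations *)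

Section WordCongruence.
Variable X : Type.
Implicit Types (u v w x y : word X) (rels : word X -> Prop).

Definition linv (l : X * bool) := (l.1, ~~ l.2).

Lemma linvK : involutive linv. Proof. by case=> x b; rewrite /linv /= negbK. Qed.

Lemma weq_cancelV rels u v l : weq rels (u ++ [:: linv l; l] ++ v) (u ++ v).
Proof. by rewrite -{2}[l]linvK; apply: weq_cancel. Qed.

Lemma winv_cat u v : winv (u ++ v) = winv v ++ winv u.
Proof. by rewrite /winv map_cat rev_cat. Qed.

Lemma winv_cons l u : winv (l :: u) = winv u ++ [:: linv l].
Proof. by rewrite /winv /= rev_cons cats1. Qed.

Lemma winvK : involutive (@winv X).
Proof.
by elim=> [//|[x b] u IH]; rewrite winv_cons winv_cat IH /winv /= negbK.
Qed.

Lemma size_winv u : size (winv u) = size u.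
Proof. by rewrite /winv size_rev size_map. Qed.

Lemma weq_cat2l rels x u v : weq rels u v -> weq rels (x ++ u) (x ++ v).
Proof.
elim=> [u1|u1 v1 _|u1 v1 w1 _ + _|u1 v1 l|u1 v1 r rr].
- exact: weq_refl.
- exact: weq_sym.
- exact: weq_trans.
- by rewrite !(catA x); apply: weq_cancel.
- by rewrite !(catA x); apply: weq_relator.
Qed.

Lemma weq_cat2r rels x u v : weq rels u v -> weq rels (u ++ x) (v ++ x).
Proof.
elim=> [u1|u1 v1 _|u1 v1 w1 _ + _|u1 v1 l|u1 v1 r rr].
- exact: weq_refl.
- exact: weq_sym.
- exact: weq_trans.
- by rewrite -!catA; apply: weq_cancel.
- by rewrite -!catA; apply: weq_relator.
Qed.

#[export] Instance weq_equivalence rels : RelationClasses.Equivalence (weq rels).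
Proof. split; [exact: weq_refl|exact: weq_sym|exact: weq_trans]. Qed.

#[export] Instance cat_weq_proper rels :
  Morphisms.Proper (Morphisms.respectful (weq rels)
    (Morphisms.respectful (weq rels) (weq rels))) (@cat (X * bool)).
Proof.
move=> u u' uu' v v' vv'.
by apply: weq_trans (weq_cat2l _ vv'); apply: weq_cat2r.
Qed.

Lemma weq_winvr rels u : weq rels (u ++ winv u) [::].
Proof.
elim/last_ind: u => [|u l IH]; first exact: weq_refl.
rewrite -cats1 winv_cat -catA.
by apply: weq_trans IH; apply: (weq_cancel rels u (winv u) l).
Qed.

Lemma weq_winvl rels u : weq rels (winv u ++ u) [::].
Proof. by rewrite -{2}[u]winvK; apply: weq_winvr. Qed.

Lemma weq_catK rels x u v : weq rels (x ++ u) (x ++ v) -> weq rels u v.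
Proof.
move=> /(weq_cat2l (winv x)); rewrite !catA => H.
by apply: weq_trans (weq_trans _ H) _;
  rewrite ?(weq_winvl rels x); apply: weq_refl.
Qed.

Lemma weq_catKr rels x u v : weq rels (u ++ x) (v ++ x) -> weq rels u v.
Proof.
move=> /(weq_cat2r (winv x)); rewrite -!catA => H.
by apply: weq_trans (weq_trans _ H) _;
  rewrite ?(weq_winvr rels x) cats0; apply: weq_refl.
Qed.

#[export] Instance winv_weq_proper rels :
  Morphisms.Proper (Morphisms.respectful (weq rels) (weq rels)) (@winv X).
Proof.
move=> u v uv; apply: (@weq_catKr _ u); rewrite weq_winvl uv weq_winvl.
exact: weq_refl.
Qed.

Lemma weq_free rels u v : freely_equal u v -> weq rels u v.
Proof.
elim=> [u1|u1 v1 _|u1 v1 w1 _ + _|u1 v1 l|//].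
- exact: weq_refl.
- exact: weq_sym.
- exact: weq_trans.
- exact: weq_cancel.
Qed.

End WordCongruence.

(** Invariance under all relations only has to be checked on letters and on
    relators, when a word acts letter by letter on a set of states. *)
Lemma foldl_weq (X T : Type) (rels : word X -> Prop) (step : T -> X * bool -> T)
    (P : T -> Prop) :
    (forall s l, P s -> P (step s l)) ->
    (forall s l, P s -> step (step s l) (linv l) = s) ->
    (forall s r, P s -> rels r -> foldl step s r = s) ->
  forall u v s, P s -> weq rels u v -> foldl step s u = foldl step s v.
Proof.
move=> Pstep stepK steprel u v s Ps uv.
have Pfold w s' : P s' -> P (foldl step s' w).
  by elim: w s' => //= l w IH s' /Pstep/IH.
elim: uv s Ps => [//|u1 v1 _ IH|u1 v1 w1 _ IH1 _ IH2|u1 v1 l|u1 v1 r rr] s Ps.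
- by rewrite IH.
- by rewrite IH1 // IH2.
- by rewrite !foldl_cat /= (stepK _ l) //; apply: Pfold.
- by rewrite !foldl_cat (steprel _ r) //; apply: Pfold.
Qed.

(** * Normal forms in the group *)

Lemma G_relatorsP r : r \in G_relators ->
  exists t, (t = theta1 \/ t = theta2) /\
    (r = [:: (t, true); (gen_a, false); (t, false); (gen_a, true)] \/
     r = [:: (t, true); (gen_k, false); (t, false); (gen_a, true); (gen_k, true)]).
Proof.
rewrite /G_relators /= !inE => /or4P[] /eqP ->.
- by exists theta1; split; left.
- by exists theta1; split; [left|right].
- by exists theta2; split; [right|left].
- by exists theta2; split; right.
Qed.

(** The theta part of a word is a reduced word in the free group on theta1 (false)
    and theta2 (true), kept as a stack with its last letter on top. *)
Definition tpush (t : bool * bool) (s : word bool) : word bool :=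
  if s is t' :: s' then if t' == linv t then s' else t :: s else [:: t].

Definition tstep (s : word bool) (l : gen * bool) : word bool :=
  match l.1 with
  | theta1 => tpush (false, l.2) s
  | theta2 => tpush (true, l.2) s
  | _ => s
  end.

Definition trun := foldl tstep.

Definition treduced : pred (word bool) := sorted (fun t t' => t' != linv t).

Lemma tpush_reduced t s : treduced s -> treduced (tpush t s).
Proof.
case: s => [//|t' s] /= ps; case: (eqVneq t' (linv t)) => [_|t't].
  exact: path_sorted ps.
by rewrite /= t't.
Qed.

Lemma tpushK t s : treduced s -> tpush (linv t) (tpush t s) = s.
Proof.
case: s => [|t' s] /=; first by rewrite linvK eqxx.
case: (eqVneq t' (linv t)) => [-> |_ _] /=; last by rewrite linvK eqxx.
by case: s => [//|t2 s] /=; rewrite linvK => /andP[/negPf ->].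
Qed.

Lemma tstep_reduced s l : treduced s -> treduced (tstep s l).
Proof. by case: l => [[] b] //; apply: tpush_reduced. Qed.

Lemma trun_group_eq u v s : treduced s ->
  group_eq G_relators u v -> trun s u = trun s v.
Proof.
move=> rs uv; apply: (@foldl_weq _ _ _ _ treduced) rs uv;
  first exact: tstep_reduced.
- by move=> s' [[] b] //= rs; apply: (tpushK (_, b)).
- move=> s' r rs /G_relatorsP[t [[] -> [] ->]] /=; exact: (tpushK (_, true)).
Qed.

Definition is_theta (l : gen * bool) : bool :=
  match l.1 with theta1 | theta2 => true | _ => false end.

Definition sgz_of (b : bool) : int := if b then -1 else 1.

(** As [t k t^-1 = k a^-e] for a theta word [t] of exponent sum [e], moving all
    theta letters of a word to its right end leaves a word in [a] and [k].  A state
    [(e, m, s)] records the exponent sum read so far and the reduced form of that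
    word: [m] is the exponent of the last run of [a], and an entry [(b, v)] of the
    stack [s] is a letter [k] ([b] false) or [k^-1] ([b] true) preceded by [a^v]. *)
Definition kstate := (int * int * seq (bool * int))%type.

Definition kstep (st : kstate) (l : gen * bool) : kstate :=
  let: (e, m, s) := st in
  match l with
  | (gen_a, b) => (e, m + sgz_of b, s)
  | (gen_k, false) =>
      match s with
      | (true, m') :: s' =>
          if m == 0 then (e, m' - e, s') else (e, - e, (false, m) :: s)
      | _ => (e, - e, (false, m) :: s)
      end
  | (gen_k, true) =>
      match s with
      | (false, m') :: s' =>
          if m + e == 0 then (e, m', s') else (e, 0, (true, m + e) :: s)
      | _ => (e, 0, (true, m + e) :: s)
      end
  | (_, b) => (e + sgz_of b, m, s)
  end.

Definition krun := foldl kstep.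

(** The stack spells a reduced word. *)
Definition kreduced (st : kstate) : bool :=
  sorted (fun x y => (x.2 != 0) || (x.1 == y.1)) st.2.

Lemma kstep_reduced st l : kreduced st -> kreduced (kstep st l).
Proof.
case: st l => [[e m] s] [[] b] //; rewrite /kreduced /=; case: b => /=.
- case: s => [//|[[] v] s] /= ps; first by rewrite /= orbT.
  case: (eqVneq (m + e) 0) => [_|me] /=; first exact: path_sorted ps.
  by rewrite me.
- case: s => [//|[[] v] s] /= ps; last by rewrite /= orbT.
  case: (eqVneq m 0) => [_|me] /=; first exact: path_sorted ps.
  by rewrite me.
Qed.

Lemma kstepK st l : kreduced st -> kstep (kstep st l) (linv l) = st.
Proof.
case: st l => [[e m] s] [[] []]; rewrite /kreduced /linv //=;
  rewrite ?addrK ?subrK //; try by rewrite -addrA ?subrr ?addNr addr0.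
- case: s => [|[[] v] s] /=; rewrite ?eqxx ?addrK //.
  case: (eqVneq (m + e) 0) => [me|_] /=; last by rewrite ?eqxx addrK.
  have -> : m = - e by apply/eqP; rewrite -subr_eq0 opprK me.
  by case: s => [//|[[] v'] s] /= /andP[]; rewrite ?orbF // => /negPf ->.
- case: s => [|[[] v] s] /=; rewrite ?addNr ?eqxx //.
  case: (eqVneq m 0) => [->|_] /=; last by rewrite addNr ?eqxx.
  by case: s => [|[[] v'] s] /=; rewrite subrK // orbF => /andP[/negPf ->].
Qed.

Lemma krun_group_eq u v st : kreduced st ->
  group_eq G_relators u v -> krun st u = krun st v.
Proof.
move=> rst uv; apply: (@foldl_weq _ _ _ _ kreduced) rst uv;
  [exact: kstep_reduced|exact: kstepK|].
move=> {}st r rst /G_relatorsP[t [tE rE]].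
have theta_a e m s : krun (e, m, s) [:: (t, true); (gen_a, false); (t, false);
    (gen_a, true)] = (e, m, s).
  by case: tE => -> /=; rewrite subrK addrK.
have theta_k e m s : krun (e, m, s) [:: (t, true); (gen_k, false); (t, false);
    (gen_a, true)] = kstep (e, m, s) (gen_k, false).
  case: tE => -> /=; case: s => [|[[] v'] s] /=; rewrite ?subrK ?addrK;
  by try (case: (m == 0) => /=); rewrite ?subrK //; congr (_, _, _); ring.
case: st rst => [[e m] s] rst; case: rE => -> {r}; first exact: theta_a.
rewrite -[foldl _ _ _]/(kstep (krun (e, m, s) [:: (t, true); (gen_k, false);
  (t, false); (gen_a, true)]) (gen_k, true)) theta_k.
exact: kstepK rst.
Qed.

(** * Fillings with few relators and short conjugators *)

(** The number of relators and the length of the conjugators are bounded together,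
    since one and the same filling is good for both. *)
Definition fillable (A D : nat) (u v : word gen) : Prop :=
  exists ps, [/\ relator_pairs G_relators ps,
                 freely_equal (u ++ winv v) (conj_product ps),
                 (size ps <= A)%N & forall p, p \in ps -> (size p.2 <= D)%N].

Lemma fillableW A D A' D' u v : (A <= A')%N -> (D <= D')%N ->
  fillable A D u v -> fillable A' D' u v.
Proof.
move=> AA DD [ps [rps ups szps Dps]]; exists ps; split=> //.
  exact: leq_trans AA.
by move=> p /Dps/leq_trans; apply.
Qed.

Lemma fillable_free u v : freely_equal u v -> fillable 0 0 u v.
Proof.
by move=> uv; exists [::]; split=> //; rewrite uv; apply: weq_winvr.
Qed.

Lemma fillable_relator u v : u ++ winv v \in G_relators -> fillable 1 0 u v.
Proof.
move=> r; exists [:: (u ++ winv v, [::])]; split=> //.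
- by move=> p; rewrite inE => /eqP ->; left.
- by rewrite /conj_product /= /wconj /= !cats0; apply: weq_refl.
- by move=> p; rewrite inE => /eqP ->.
Qed.

Lemma fillable_trans A A' D v u w :
  fillable A D u v -> fillable A' D v w -> fillable (A + A') D u w.
Proof.
move=> [ps [rps ups szps Dps]] [qs [rqs uqs szqs Dqs]]; exists (ps ++ qs); split.
- by move=> p; rewrite mem_cat => /orP[/rps|/rqs].
- rewrite /conj_product map_cat flatten_cat -[flatten _]/(conj_product ps).
  rewrite -[flatten (map _ qs)]/(conj_product qs) -ups -uqs -catA.
  rewrite (catA (winv v) v) weq_winvl; exact: weq_refl.
- by rewrite size_cat leq_add.
- by move=> p; rewrite mem_cat => /orP[/Dps|/Dqs].
Qed.

Lemma fillable_freel A D u v w :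
  freely_equal u v -> fillable A D v w -> fillable A D u w.
Proof.
by move=> uv vw; apply: (fillable_trans (fillableW (leqnn 0) _ (fillable_free uv))) vw.
Qed.

Lemma fillable_freer A D u v w :
  fillable A D u v -> freely_equal v w -> fillable A D u w.
Proof.
move=> uv vw; rewrite -[A]addn0; apply: fillable_trans uv _.
exact: fillableW (leqnn 0) _ (fillable_free vw).
Qed.

Lemma fillable_context A D x y u v :
  fillable A D u v -> fillable A (D + size x) (x ++ u ++ y) (x ++ v ++ y).
Proof.
move=> [ps [rps ups szps Dps]]; exists [seq (p.1, p.2 ++ winv x) | p <- ps]; split.
- by move=> _ /mapP[p /rps pr ->].
- have -> : freely_equal (conj_product [seq (p.1, p.2 ++ winv x) | p <- ps])
      (x ++ conj_product ps ++ winv x).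
    elim: ps {rps ups szps Dps} => [|p ps IH]; first by rewrite weq_winvr; apply: weq_refl.
    rewrite /conj_product /= -[flatten _]/(conj_product _) IH /wconj.
    rewrite winv_cat winvK -!catA (catA (winv x) x) weq_winvl.
    exact: weq_refl.
  rewrite -ups !winv_cat -!catA (catA y (winv y)) weq_winvr; exact: weq_refl.
- by rewrite size_map.
- by move=> _ /mapP[p /Dps pD ->]; rewrite size_cat size_winv leq_add2r.
Qed.

Lemma fillable_sym A D u v : fillable A D u v -> fillable A D v u.
Proof.
move=> [ps [rps ups szps Dps]]; exists (rev [seq (winv p.1, p.2) | p <- ps]); split.
- move=> p; rewrite mem_rev => /mapP[q /rps qr ->] /=; rewrite winvK.
  by case: qr; [right|left].
- have -> : freely_equal (v ++ winv u) (winv (u ++ winv v)).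
    by rewrite winv_cat winvK; apply: weq_refl.
  rewrite ups {ups rps szps Dps}; elim: ps => [|p ps IH]; first exact: weq_refl.
  rewrite /= rev_cons -cats1 /conj_product map_cat flatten_cat /=.
  rewrite -![flatten _]/(conj_product _) -IH winv_cat cats0 /wconj !winv_cat winvK -!catA.
  exact: weq_refl.
- by rewrite size_rev size_map.
- by move=> p; rewrite mem_rev => /mapP[q /Dps qD ->].
Qed.

Lemma fillable_inv A D u v :
  fillable A D u v -> fillable A (D + size v) (winv u) (winv v).
Proof.
move=> /(fillable_context (winv v) (winv u)); rewrite size_winv => uv.
apply: fillable_sym; apply: (fillable_freel _ (fillable_freer uv _)).
- rewrite weq_winvr cats0; exact: weq_refl.
- rewrite catA weq_winvl; exact: weq_refl.
Qed.

Definition apow (j : int) : word gen := nseq `|j| (gen_a, j < 0).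

Lemma size_apow j : size (apow j) = `|j|%N. Proof. exact: size_nseq. Qed.

Lemma apow_rcons j b :
  freely_equal (apow j ++ [:: (gen_a, b)]) (apow (j + sgz_of b)).
Proof.
have cancel n c : freely_equal (nseq n.+1 (gen_a, c) ++ [:: (gen_a, ~~ c)])
    (nseq n (gen_a, c)).
  rewrite -addn1 nseqD -catA -{2}[nseq n _]cats0.
  exact: (weq_cancel _ _ [::] (gen_a, c)).
have extend n c : nseq n (gen_a, c) ++ [:: (gen_a, c)] = nseq n.+1 (gen_a, c).
  by rewrite -[n.+1]addn1 nseqD.
case: j => [[|n]|n]; case: b => /=; rewrite /apow.
- exact: weq_refl.
- exact: weq_refl.
- rewrite (_ : n.+1%:Z + -1 = n%:Z); [exact: (cancel n false)|lia].
- rewrite (_ : n.+1%:Z + 1 = n.+2%:Z); last lia.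
  by rewrite extend; apply: weq_refl.
- rewrite (_ : Negz n + -1 = Negz n.+1); last lia.
  by rewrite extend; apply: weq_refl.
- rewrite (_ : Negz n + 1 = - n%:Z); last lia.
  by rewrite abszN; case: n => [|n]; [exact: (cancel 0 true)|exact: (cancel n.+1 true)].
Qed.

Lemma apowD i j : freely_equal (apow i ++ apow j) (apow (i + j)).
Proof.
have H n b : freely_equal (apow i ++ nseq n (gen_a, b)) (apow (i + n%:Z * sgz_of b)).
  elim: n => [|n IH]; first by rewrite cats0 mul0r addr0; apply: weq_refl.
  rewrite -[n.+1]addn1 nseqD catA IH apow_rcons PoszD mulrDl mul1r addrA.
  exact: weq_refl.
rewrite {1}[in apow j]/apow H; case: j => n; rewrite /sgz_of /= ?mulr1; first exact: weq_refl.
by rewrite mulrN1 NegzE; apply: weq_refl.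
Qed.

Lemma winv_apow j : freely_equal (winv (apow j)) (apow (- j)).
Proof.
apply: (@weq_catK _ _ (apow j)).
by rewrite weq_winvr apowD subrr; apply: weq_refl.
Qed.

Lemma theta_letter_split (t : gen * bool) : is_theta t ->
  exists x b, t = (x, b) /\ (x = theta1 \/ x = theta2).
Proof. by case: t => [[] b] // _; [exists theta1|exists theta2]; exists b; auto. Qed.

Lemma fillable_theta_a t b : is_theta t ->
  fillable 1 2 [:: t; (gen_a, b); linv t] [:: (gen_a, b)].
Proof.
move=> /theta_letter_split[x [c [-> xE]]] {t}.
have R : fillable 1 0 [:: (x, true); (gen_a, false); (x, false)] [:: (gen_a, false)].
  by apply: fillable_relator; case: xE => ->; rewrite /G_relators /= !inE eqxx ?orbT.
have R1 : fillable 1 1 [:: (x, c); (gen_a, false); (x, ~~ c)] [:: (gen_a, false)].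
  case: c; first exact: fillableW R.
  have := fillable_context [:: (x, false)] [:: (x, true)] (fillable_sym R).
  rewrite add0n => /fillable_freer; apply => /=.
  rewrite -[X in freely_equal X _]/([::] ++ [:: (x, false); (x, true)] ++
    [:: (gen_a, false)] ++ [:: (x, false); (x, true)] ++ [::]).
  have cc : freely_equal [:: (x, false); (x, true)] [::].
    exact: (weq_cancel _ [::] [::] (x, false)).
  rewrite cc; exact: weq_refl.
case: b; last exact: fillableW R1.
have /= := fillable_inv R1; rewrite /winv /rev /= negbK; exact.
Qed.

Lemma fillable_theta_apow t n b : is_theta t ->
  fillable n (n + 2) ([:: t] ++ nseq n (gen_a, b) ++ [:: linv t]) (nseq n (gen_a, b)).
Proof.
move=> tt; elim: n => [|n IH].
  apply: fillableW (leqnn _) _ (fillable_free _) => //.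
  exact: (weq_cancel _ [::] [::] t).
have H1 := fillable_context [::] ([:: t] ++ nseq n (gen_a, b) ++ [:: linv t])
  (fillable_theta_a b tt).
have H2 := fillable_context [:: (gen_a, b)] [::] IH.
rewrite !cats0 in H2.
apply: fillable_freel (fillable_trans (A := 1) (A' := n)
  (fillableW _ _ H1) (fillableW _ _ H2)) => //=;
  try by rewrite /=; lia.
apply: weq_sym.
exact: (weq_cancelV _ [:: t; (gen_a, b)] (nseq n (gen_a, b) ++ [:: linv t]) t).
Qed.

Lemma fillable_theta_k t : is_theta t ->
  fillable 2 3 [:: t; (gen_k, false); linv t] ((gen_k, false) :: apow (- sgz_of t.2)).
Proof.
move=> tt; have [x [c [tE xE]]] := theta_letter_split tt; rewrite {}tE in tt *.
have R : fillable 1 0 [:: (x, true); (gen_k, false); (x, false)]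
    [:: (gen_k, false); (gen_a, false)].
  by apply: fillable_relator; case: xE => ->; rewrite /G_relators /= !inE eqxx ?orbT.
case: c tt => tt; first exact: fillableW R.
have H1 := fillable_context [:: (x, false)]
  [:: (x, true); (x, false); (gen_a, true); (x, true)] (fillable_sym R).
have H2 := fillable_context [:: (gen_k, false)] [::] (fillable_theta_a true tt).
apply: fillable_freel (fillable_trans (A := 1) (A' := 1) (fillableW _ _ H1)
  (fillable_freel _ (fillableW _ _ H2))) => //=.
- apply: weq_sym.
  apply: weq_trans (weq_cancel _ [:: (x, false); (gen_k, false); (gen_a, false)]
    [:: (gen_a, true); (x, true)] (x, true)) _.
  exact: (weq_cancel _ [:: (x, false); (gen_k, false)] [:: (x, true)] (gen_a, false)).
- apply: weq_trans (weq_cancel _ [::] [:: (gen_k, false); (x, false); (x, true); (x, false);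
    (gen_a, true); (x, true)] (x, false)) _.
  exact: (weq_cancel _ [:: (gen_k, false)] [:: (x, false); (gen_a, true); (x, true)] (x, false)).
Qed.

Definition tsum (w : word gen) : int := \sum_(l <- w | is_theta l) sgz_of l.2.

Lemma tsum_cons l u :
  tsum (l :: u) = (if is_theta l then sgz_of l.2 else 0) + tsum u.
Proof. by rewrite /tsum big_cons; case: ifP; rewrite ?add0r. Qed.

Lemma tsum_cat u v : tsum (u ++ v) = tsum u + tsum v.
Proof. exact: big_cat. Qed.

Lemma abs_tsum_le u : (`|tsum u| <= size u)%N.
Proof.
elim: u => [|[x b] u IH]; first by rewrite /tsum big_nil.
by rewrite tsum_cons /=; case: ifP => _; case: b => /=; lia.
Qed.

Lemma krun_tsum u e m s : (krun (e, m, s) u).1.1 = e + tsum u.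
Proof.
elim: u e m s => [|[x b] u IH] e m s; first by rewrite /tsum big_nil addr0.
have -> : krun (e, m, s) ((x, b) :: u) = krun (kstep (e, m, s) (x, b)) u by [].
have : (kstep (e, m, s) (x, b)).1.1 = e + (if is_theta (x, b) then sgz_of b else 0).
  case: x; rewrite /= ?addr0 //; case: b => //.
    by case: s => [|[[] v] s] //=; case: ifP.
  by case: s => [|[[] v] s] //=; case: ifP.
case: (kstep _ _) => [[e' m'] s'] /= e'E.
by rewrite IH e'E tsum_cons addrA.
Qed.

(** Each of the [size u] letters meets a word [k a^i] with [|i|] at most
    [|j| + size u], so pushing it through costs linearly many relators. *)
Lemma fillable_conj_k (u : word gen) j : all is_theta u ->
  fillable (size u * (2 + `|j| + size u)) (2 * size u + `|j| + 4)
    (u ++ ((gen_k, false) :: apow j) ++ winv u) ((gen_k, false) :: apow (j - tsum u)).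
Proof.
elim/last_ind: u j => [|u t IH] j.
  move=> _; apply: fillableW (leqnn _) _ (fillable_free _) => //.
  by rewrite /= cats0 /tsum big_nil subr0; apply: weq_refl.
rewrite all_rcons size_rcons => /andP[tt uu].
pose kt := (gen_k, false) :: apow (- sgz_of t.2).
have H1 : fillable 2 (`|j| + 4) (t :: (gen_k, false) :: apow j ++ [:: linv t])
    (kt ++ [:: t] ++ apow j ++ [:: linv t]).
  have := fillable_context [::] ([:: t] ++ apow j ++ [:: linv t]) (fillable_theta_k tt).
  move=> /(fillableW (leqnn 2) (_ : _ <= `|j| + 4)%N) H.
  apply: fillable_freel (H _); last by rewrite /=; lia.
  apply: weq_sym.
  exact: (weq_cancelV _ [:: t; (gen_k, false)] (apow j ++ [:: linv t]) t).
have H2 : fillable `|j| (`|j| + 4) (kt ++ [:: t] ++ apow j ++ [:: linv t])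
    ((gen_k, false) :: apow (j - sgz_of t.2)).
  have := fillable_context kt [::] (fillable_theta_apow `|j| (j < 0) tt).
  rewrite !cats0 => /(fillableW (leqnn _) (_ : _ <= `|j| + 4)%N) H.
  apply: fillable_freer (H _) _; first by rewrite /= size_apow; case: (t.2) => /=; lia.
  rewrite -[X in freely_equal X _]/([:: (gen_k, false)] ++ (_ ++ apow j)).
  rewrite -[X in freely_equal _ X]/([:: (gen_k, false)] ++ _).
  rewrite apowD addrC; exact: weq_refl.
have H4 := fillable_context u (winv u) (fillable_trans H1 H2).
have H5 := fillable_trans (fillableW (leqnn _) (_ : _ <= 2 * (size u).+1 + `|j| + 4)%N H4)
  (fillableW (leqnn _) _ (IH (j - sgz_of t.2) uu)).
have eqj : (j - sgz_of t.2 - tsum u) = j - tsum (rcons u t).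
  by rewrite -cats1 tsum_cat tsum_cons tt /tsum big_nil; ring.
rewrite eqj in H5.
apply: fillable_freel (fillableW _ (leqnn _) (H5 _ _)).
- rewrite -cats1 winv_cat /= -!catA /=; exact: weq_refl.
- have : (`|(j - sgz_of t.2)| <= `|j| + 1)%N by case: (t.2) => /=; lia.
  nia.
- lia.
- by case: (t.2) => /=; lia.
Qed.

(** The word in [a] and [k] equal to [t l t^-1], for a theta word [t] of exponent
    sum [e]. *)
Definition untwist (e : int) (l : gen * bool) : word gen :=
  match l with
  | (gen_k, false) => (gen_k, false) :: apow (- e)
  | (gen_k, true) => apow e ++ [:: (gen_k, true)]
  | _ => [:: l]
  end.

Lemma fillable_untwist (u : word gen) l : all is_theta u -> ~~ is_theta l ->
  fillable (size u * (size u + 2)) (3 * size u + 5)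
    (u ++ [:: l] ++ winv u) (untwist (tsum u) l).
Proof.
move=> uu; have K := fillable_conj_k 0 uu.
have K1 : fillable (size u * (size u + 2)) (2 * size u + 4)
    (u ++ [:: (gen_k, false)] ++ winv u) ((gen_k, false) :: apow (- tsum u)).
  rewrite -[- tsum u]sub0r; apply: fillableW K; nia.
case: l => [[] b] //= _; last first.
  case: b; last by apply: fillableW K1 => //; lia.
  have := fillable_inv K1; rewrite !winv_cat winvK -catA => H.
  apply: fillable_freer (fillableW (leqnn _) _ H) _.
    rewrite /= size_apow.
    have := abs_tsum_le u; lia.
  rewrite winv_cons winv_apow opprK; exact: weq_refl.
apply: (@fillableW (size u) (size u + 2)); try nia.
elim/last_ind: u uu {K K1} => [|u t IH].
  move=> _; apply: fillableW (leqnn _) _ (fillable_free _) => //; exact: weq_refl.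
rewrite all_rcons size_rcons => /andP[tt uu].
have H := fillable_context u (winv u) (fillable_theta_a b tt).
apply: fillable_freel (fillable_trans (A := 1) (A' := size u) (fillableW _ _ H)
  (fillableW _ _ (IH uu))); try lia.
by rewrite -cats1 winv_cat -!catA; apply: weq_refl.
Qed.

Fixpoint kspell_stack (s : seq (bool * int)) : word gen :=
  if s is (b, v) :: s' then kspell_stack s' ++ apow v ++ [:: (gen_k, b)] else [::].

Definition kspell (st : kstate) : word gen := kspell_stack st.2 ++ apow st.1.2.

Lemma kspell_step st l : ~~ is_theta l ->
  freely_equal (kspell (kstep st l)) (kspell st ++ untwist st.1.1 l).
Proof.
case: st l => [[e m] s] [[] b] // _; rewrite /kspell /=.
  by rewrite -catA apow_rcons; apply: weq_refl.
have push c x y : freely_equal (kspell_stack ((c, x) :: s) ++ apow y)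
    ((kspell_stack s ++ apow x) ++ [:: (gen_k, c)] ++ apow y).
  by rewrite /= -!catA; apply: weq_refl.
have popk s' v y : freely_equal (kspell_stack ((true, v) :: s') ++
    [:: (gen_k, false)] ++ apow y) (kspell_stack s' ++ apow (v + y)).
  rewrite -apowD /= -!catA catA.
  rewrite [X in freely_equal _ X]catA.
  exact: (weq_cancel _ _ _ (gen_k, true)).
have popK s' v : freely_equal (kspell_stack ((false, v) :: s') ++
    [:: (gen_k, true)]) (kspell_stack s' ++ apow v).
  rewrite /= -!catA catA -[X in freely_equal _ X]cats0.
  exact: (weq_cancel _ _ _ (gen_k, false)).
case: b => /=.
- have me : freely_equal ((kspell_stack s ++ apow m) ++ apow e ++ [:: (gen_k, true)])
      (kspell_stack s ++ apow (m + e) ++ [:: (gen_k, true)]).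
    by rewrite -apowD -!catA; apply: weq_refl.
  rewrite {}me.
  have P : freely_equal (kspell_stack ((true, m + e) :: s) ++ apow 0)
      (kspell_stack s ++ apow (m + e) ++ [:: (gen_k, true)]).
    by rewrite cats0; apply: weq_refl.
  case: s push P => [//|[[] v] s] push P //.
  case: (eqVneq (m + e) 0) => [me|_] //=; rewrite me.
  by rewrite -popK; apply: weq_refl.
- have P := push false m (- e).
  case: s push P => [//|[[] v] s] push P //.
  case: (eqVneq m 0) => [->|_] //=.
  by rewrite -popk /= cats0; apply: weq_refl.
Qed.

(** The theta letters are pushed to the right end letter by letter.  The
    relators used for a new letter are put in front of all the others, so they
    are conjugated by a prefix of [w] and a theta word only; inserting them
    behind the word in [a] and [k] produced so far, which can have quadratic
    length, would spoil the bound on the conjugators. *)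
Lemma fillable_normal_form (w : word gen) :
  fillable (size w * (size w * (size w + 2))) (5 * size w + 5)
    w (kspell (krun (0, 0, [::]) w) ++ [seq l <- w | is_theta l]).
Proof.
elim/last_ind: w => [|w l IH].
  by apply: fillableW (leqnn _) _ (fillable_free _) => //; apply: weq_refl.
set u := [seq l <- w | is_theta l] in IH *; set st := krun _ w in IH *.
rewrite size_rcons filter_rcons -/u /krun foldl_rcons -/(krun _ w) -/st.
have IHl := fillable_context [::] [:: l] IH; rewrite addn0 in IHl.
case: ifPn => tl.
  rewrite -!cats1; apply: fillable_freer (fillableW _ _ IHl) _; try nia.
  rewrite [kspell (kstep _ _)](_ : _ = kspell st) /= -?catA; last first.
    by case: (st) l tl {IHl} => [[e m] s] [[] b].
  rewrite cats1; exact: weq_refl.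
have su : (size u <= size w)%N by rewrite size_filter count_size.
have uu : all is_theta u by rewrite filter_all.
have est : st.1.1 = tsum u.
  rewrite /st krun_tsum add0r /u; elim: (w) => [//|l' v IHv] /=.
  by rewrite tsum_cons; case: ifP => l't; rewrite ?tsum_cons ?l't IHv ?add0r.
have H1 := fillable_context (w ++ winv u) u (fillable_untwist uu tl).
have H2 := fillable_context [::] (winv u ++ untwist (tsum u) l ++ u) IH.
rewrite /= addn0 catA in H2.
have H3 : freely_equal (rcons w l)
    ((w ++ winv u) ++ (u ++ [:: l] ++ winv u) ++ u).
  rewrite -!catA (catA (winv u) u) weq_winvl.
  by rewrite -cats1; apply: weq_refl.
have H4 : freely_equal ((kspell st ++ u) ++ winv u ++ untwist (tsum u) l ++ u)
    (kspell (kstep st l) ++ u).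
  rewrite kspell_step // est -!catA (catA u (winv u)) weq_winvr; exact: weq_refl.
rewrite -!catA in H1; rewrite -!catA in H2.
have H5 := fillable_trans (fillableW (leqnn _) (_ : _ <= 5 * (size w).+1 + 5)%N H1)
  (fillableW (leqnn _) _ H2).
rewrite -!catA in H3; rewrite -!catA in H4.
apply: fillable_freel H3 _.
rewrite /kspell -!catA; apply: fillable_freer _ H4.
apply: fillableW _ (leqnn _) (H5 _ _).
- have : (size u * (size u + 2) <= size w * (size w + 2))%N by rewrite leq_mul ?leq_add2r.
  nia.
- by rewrite size_cat size_winv; lia.
- lia.
Qed.

Definition tspell (s : word bool) : word gen :=
  rev [seq (if t.1 then theta2 else theta1, t.2) | t <- s].

Lemma tspell_trun w : freely_equal ([seq l <- w | is_theta l]) (tspell (trun [::] w)).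
Proof.
elim/last_ind: w => [|w l IH]; first exact: weq_refl.
rewrite filter_rcons /trun foldl_rcons -/(trun _ w).
have push t s : freely_equal
    (tspell s ++ [:: (if t.1 then theta2 else theta1, t.2)]) (tspell (tpush t s)).
  case: s => [|t' s]; first exact: weq_refl.
  rewrite /tpush; case: (eqVneq t' (linv t)) => [->|_].
    rewrite /tspell /= rev_cons -cats1 -catA.
    rewrite -[X in freely_equal _ X]cats0.
    exact: (weq_cancelV _ _ [::] (_, t.2)).
  by rewrite /tspell [X in freely_equal _ X]/= !rev_cons -!cats1 -!catA; apply: weq_refl.
case: l => [[] b] //=; rewrite -cats1 IH.
  exact: (push (false, b)).
exact: (push (true, b)).
Qed.

Lemma fillable_trivial w : group_eq G_relators w [::] ->
  fillable (size w * (size w * (size w + 2))) (5 * size w + 5) w [::].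
Proof.
move=> w1; have := fillable_normal_form w.
rewrite (krun_group_eq _ w1) // => /fillable_freer; apply.
by rewrite /kspell /= tspell_trun (trun_group_eq _ w1) //; apply: weq_refl.
Qed.

Lemma G_cubic_isoperimetric : isoperimetric G_relators (fun n => n * (n * (n + 2)))%N.
Proof.
move=> w /fillable_trivial[ps []]; rewrite cats0 => rps wps szps _.
by exists ps.
Qed.

Lemma G_linear_isodiametric : isodiametric G_relators (fun n => 10 * n)%N.
Proof.
move=> w /fillable_trivial[ps []]; rewrite cats0 => rps wps szps Dps.
exists ps; split=> // p pps; apply: leq_trans (Dps _ pps) _.
by case: ps szps pps {rps wps Dps} => // q ps; case: (size w) => //= n _ _; lia.
Qed.

(** * Long runs survive multiplication by short words *)

Definition long_runs (r : nat) (s : seq (bool * int)) : nat :=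
  count (fun x => r%:Z < `|x.2|) s.

(** [q] is the part of the initial stack [s0] that has not been touched yet, and
    [o] was the initial value of the run just above it. *)
Definition untouched (r : nat) (m0 : int) (s0 q : seq (bool * int)) (o : int) :=
  (q = s0 /\ o = m0) \/ exists p b, s0 = p ++ (b, o) :: q /\ long_runs r p = 0.

(** The current value of that run, read relative to the present theta exponent
    when it lies under a [k^-1], drifts by at most one per letter. *)
Definition drifted (r : nat) (m0 : int) (s0 : seq (bool * int)) (n : nat)
    (st : kstate) : Prop :=
  `|st.1.1| <= n%:Z /\ exists q o, untouched r m0 s0 q o /\
  ((st.2 = q /\ `|st.1.2 - o| <= n%:Z) \/
   exists p b v, st.2 = p ++ (b, v) :: q /\
     `|v - (if b then st.1.1 else 0) - o| <= n%:Z).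

Lemma untouched_pop r m0 s0 q o b v : `|o| <= r%:Z ->
  untouched r m0 s0 ((b, v) :: q) o -> untouched r m0 s0 q v.
Proof.
move=> or [[<- <-]|[p [c [-> p0]]]]; right.
  by exists [::], b.
exists (rcons p (c, o)), b; rewrite cat_rcons; split=> //.
by rewrite /long_runs -cats1 count_cat -/(long_runs r p) p0 /= ltNge or.
Qed.

Lemma drifted_step r m0 s0 n st l : (2 * n <= r)%N ->
  drifted r m0 s0 n st -> drifted r m0 s0 n.+1 (kstep st l).
Proof.
case: st l => [[e m] s] [x b] nr [/= en [q [ o [qo D]]]].
have theta c : drifted r m0 s0 n.+1 (e + sgz_of c, m, s).
  split; first by case: c => /=; lia.
  exists q, o; split=> //=; case: D => [[-> mo]|[p [b' [v [-> vo]]]]].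
    by left; split=> //; lia.
  by right; exists p, b', v; split=> //; case: b' c vo => [|] [|]; rewrite /=; lia.
have push c : drifted r m0 s0 n.+1
    (e, if c then 0 else - e, (c, if c then m + e else m) :: s).
  split=> /=; first by lia.
  exists q, o; split=> //=; right; case: D => [[-> mo]|[p [b' [v [-> vo]]]]].
    by exists [::], c, (if c then m + e else m); split=> //; case: c; lia.
  by exists ((c, if c then m + e else m) :: p), b', v; split=> //; lia.
have pop c s' v : s = (~~ c, v) :: s' -> (if c then m + e else m) = 0 ->
    drifted r m0 s0 n.+1 (e, if c then v else v - e, s').
  move=> sE me; split=> /=; first by lia.
  case: D => [[qE mo]|[[|y p] [b' [w [wE wo]]]]].
  - exists s', v; split; last by left; split=> //; case: c {sE me}; lia.
    rewrite -qE sE in qo; apply: untouched_pop qo.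
    by case: c me {sE} => me; lia.
  - move: wE; rewrite sE => -[bE vE qE]; rewrite -{}bE -{}vE -{}qE in wo qo *.
    by exists s', o; split=> //; left; split=> //; case: c wo {sE me} => /=; lia.
  - move: wE; rewrite sE => -[_ ->].
    by exists q, o; split=> //; right; exists p, b', w; split=> //; lia.
case: x; [exact: theta|exact: theta| |].
- split=> /=; first by lia.
  exists q, o; split=> //=; case: D => [[-> mo]|[p [b' [v [-> vo]]]]].
    by left; split=> //; case: b => /=; lia.
  by right; exists p, b', v; split=> //; lia.
- rewrite /=; case: b.
    have := push true; have := pop true; case: (s) => [|[[] v] s'] //= po pu.
    by case: (eqVneq (m + e) 0) => // me; apply: (po s' v).
  have := push false; have := pop false; case: (s) => [|[[] v] s'] //= po pu.
  by case: (eqVneq m 0) => // me; apply: (po s' v).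
Qed.

(** Only the run where [h] is attached can be shortened: a run longer than
    [2 * size h] never reaches the value at which it would be cancelled. *)
Lemma long_runs_krun r (h : word gen) m0 s0 m1 s1 : (2 * size h <= r)%N ->
  krun (0, m0, s0) h = (0, m1, s1) -> (long_runs r s0 <= (long_runs r s1).+1)%N.
Proof.
move=> hr; have : drifted r m0 s0 (size h) (krun (0, m0, s0) h).
  elim/last_ind: h hr => [_|h l IH].
    split=> //; exists s0, m0; split; first by left.
    by left; split=> //; rewrite subrr.
  rewrite size_rcons => hr; rewrite /krun foldl_rcons.
  by apply: drifted_step (IH _); lia.
move=> /[swap] -> [_ [q [ o [qo D]]]].
have qs1 : (long_runs r q <= long_runs r s1)%N.
  case: D => [[<- _]//|[p [b [v [/= -> _]]]]].
  by rewrite /long_runs count_cat /=; lia.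
case: qo => [[<- _]|[p [b [-> p0]]]]; first exact: leqW.
rewrite /long_runs count_cat -/(long_runs r p) p0 /=.
by apply: leq_trans (_ : (long_runs r q).+1 <= _)%N => //; case: (_ < _)%R.
Qed.

(** * Cocycles and interfaces on a square grid *)

Lemma grid_sum (V : zmodType) (h v : nat -> nat -> V) N :
    (forall i j, (i < N)%N -> (j < N)%N ->
       h i j + v i j.+1 = v i j + h i.+1 j) ->
  \sum_(j < N) h 0 j + \sum_(i < N) v i N =
  \sum_(i < N) v i 0 + \sum_(j < N) h N j.
Proof.
move=> hv.
have row i n : (i < N)%N -> (n <= N)%N ->
    \sum_(j < n) h i j + v i n = v i 0%N + \sum_(j < n) h i.+1 j.
  move=> iN; elim: n => [_|n IH nN]; first by rewrite !big_ord0 add0r addr0.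
  by rewrite !big_ord_recr /= -addrA hv // addrA IH ?addrA // ltnW.
have H n : (n <= N)%N -> \sum_(j < N) h 0 j + \sum_(i < n) v i N =
    \sum_(i < n) v i 0 + \sum_(j < N) h n j.
  elim: n => [_|n IH nN]; first by rewrite !big_ord0 add0r addr0.
  rewrite [in LHS]big_ord_recr [in RHS]big_ord_recr /= addrA IH; last exact: ltnW.
  by rewrite -!addrA row.
exact: H.
Qed.

Section Interface.
Variables (N : nat) (col : nat -> nat -> bool).

(** [(false, (i, j))] is the edge from [(i, j)] to [(i, j.+1)], and
    [(true, (i, j))] the edge from [(i, j)] to [(i.+1, j)]. *)
Definition grid_edge := (bool * ('I_N.+1 * 'I_N.+1))%type.
Implicit Types e f : grid_edge.

Definition esrc e : nat * nat := (e.2.1 : nat, e.2.2 : nat).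
Definition etgt e : nat * nat :=
  if e.1 then (e.2.1.+1, e.2.2 : nat) else (e.2.1 : nat, e.2.2.+1).

Definition col2 (x : nat * nat) := col x.1 x.2.
Definition bicolored e := col2 (esrc e) != col2 (etgt e).

Definition in_square (a : 'I_N * 'I_N) (x : nat * nat) :=
  (a.1 <= x.1 <= a.1.+1)%N && (a.2 <= x.2 <= a.2.+1)%N.

Definition on_square a e := in_square a (esrc e) && in_square a (etgt e).

Definition interface_adj : rel grid_edge := fun e f =>
  [&& bicolored e, bicolored f & [exists a, on_square a e && on_square a f]].

Definition grid_edge_of d i j : grid_edge := (d, (inord i, inord j)).

(** Each square has an even number of bicolored sides, and they are all
    adjacent; so the signed colour change restricted to one connected class of
    bicolored edges is a cocycle, and its sum over the boundary vanishes. *)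
Lemma interface_connect j0 j1 :
    (forall j, (j <= N)%N -> col N j = false) ->
    (forall i, (0 < i)%N -> (i <= N)%N -> col i 0 = false /\ col i N = false) ->
    col 0 0 = false -> col 0 N = false ->
    (j0 < N)%N -> (j1 < N)%N ->
    col 0 j0 = false -> col 0 j0.+1 -> col 0 j1 -> col 0 j1.+1 = false ->
    (forall j, (j < N)%N -> col 0 j != col 0 j.+1 -> j = j0 \/ j = j1) ->
  connect interface_adj (grid_edge_of false 0 j0) (grid_edge_of false 0 j1).
Proof.
move=> colN side c00 c0N j0N j1N cj0 cj0' cj1 cj1' uniq_change.
set e0 := grid_edge_of _ _ _.
pose C e := bicolored e && connect interface_adj e0 e.
pose w e : int := if C e then (col2 (etgt e))%:Z - (col2 (esrc e))%:Z else 0.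
have w_mono e : ~~ bicolored e -> w e = 0 by rewrite /w /C => /negPf ->.
have Cadj a e f : on_square a e -> on_square a f -> bicolored f -> C e -> C f.
  move=> ae af bf /andP[be ce]; rewrite /C bf /=.
  apply: connect_trans ce (connect1 _).
  by rewrite /interface_adj be bf; apply/existsP; exists a; rewrite ae.
have edgeE d i j : (i <= N)%N -> (j <= N)%N ->
    esrc (grid_edge_of d i j) = (i, j) /\
    etgt (grid_edge_of d i j) = if d then (i.+1, j) else (i, j.+1).
  by move=> iN jN; rewrite /esrc /etgt /= !inordK.
have wE a e : on_square a e -> (exists2 f, on_square a f & C f) ->
    w e = (col2 (etgt e))%:Z - (col2 (esrc e))%:Z.
  move=> ae [f af Cf]; rewrite /w; case: (boolP (bicolored e)) => be.
    by rewrite (Cadj a f e).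
  by rewrite /C (negPf be); move: be; rewrite negbK => /eqP ->; rewrite subrr.
have cocycle i j : (i < N)%N -> (j < N)%N ->
    w (grid_edge_of false i j) + w (grid_edge_of true i j.+1) =
    w (grid_edge_of true i j) + w (grid_edge_of false i.+1 j).
  move=> iN jN; pose a := (Ordinal iN, Ordinal jN).
  have [s1 t1] := edgeE false i j (ltnW iN) (ltnW jN).
  have [s2 t2] := edgeE true i j.+1 (ltnW iN) jN.
  have [s3 t3] := edgeE true i j (ltnW iN) (ltnW jN).
  have [s4 t4] := edgeE false i.+1 j iN (ltnW jN).
  have a1 : on_square a (grid_edge_of false i j).
    by rewrite /on_square s1 t1 /in_square /= !leqnn !leqnSn.
  have a2 : on_square a (grid_edge_of true i j.+1).
    by rewrite /on_square s2 t2 /in_square /= !leqnn !leqnSn.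
  have a3 : on_square a (grid_edge_of true i j).
    by rewrite /on_square s3 t3 /in_square /= !leqnn !leqnSn.
  have a4 : on_square a (grid_edge_of false i.+1 j).
    by rewrite /on_square s4 t4 /in_square /= !leqnn !leqnSn.
  have [ex|none] := pselect (exists2 f, on_square a f & C f).
    by rewrite !(wE a) // s1 t1 s2 t2 s3 t3 s4 t4 /col2 /=; ring.
  have w0 e : on_square a e -> w e = 0.
    by move=> ae; rewrite /w; case: ifP => // Ce; case: none; exists e.
  by rewrite !w0.
have := grid_sum cocycle.
rewrite [X in _ + X]big1 ?addr0; last first.
  move=> i _; apply: w_mono.
  have [s t] := edgeE true i N (ltnW (ltn_ord i)) (leqnn N).
  rewrite /bicolored s t /col2 /= negbK (proj2 (side i.+1 _ _)) //.
  by case: (posnP i) => [->|i0]; rewrite ?c0N ?(proj2 (side i _ _)) // ltnW.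
rewrite [X in X + _]big1 ?add0r; last first.
  move=> i _; apply: w_mono.
  have [s t] := edgeE true i 0%N (ltnW (ltn_ord i)) (leq0n N).
  rewrite /bicolored s t /col2 /= negbK (proj1 (side i.+1 _ _)) //.
  by case: (posnP i) => [->|i0]; rewrite ?c00 ?(proj1 (side i _ _)) // ltnW.
rewrite [X in _ = X]big1; last first.
  move=> j _; apply: w_mono.
  have [s t] := edgeE false N j (leqnn N) (ltnW (ltn_ord j)).
  by rewrite /bicolored s t /col2 /= negbK !colN // ltnW.
have jj : j0 != j1 by apply: contraTneq cj1 => <-; rewrite cj0.
rewrite (bigD1 (Ordinal j0N)) //= (bigD1 (Ordinal j1N)) /=; last first.
  by rewrite -val_eqE /= eq_sym.
rewrite big1 ?addr0; last first.
  move=> j /andP[jn0 jn1]; apply: w_mono.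
  have [s t] := edgeE false 0%N j (leq0n N) (ltnW (ltn_ord j)).
  rewrite /bicolored s t /col2 /=; apply/negP => /(uniq_change _ (ltn_ord j)).
  by move=> [] jE; move: jn0 jn1; rewrite -!val_eqE /= jE eqxx ?andbF.
have [s0 t0] := edgeE false 0%N j0 (leq0n N) (ltnW j0N).
have [s1 t1] := edgeE false 0%N j1 (leq0n N) (ltnW j1N).
have -> : w e0 = 1.
  rewrite /w /C connect0 andbT /bicolored s0 t0 /col2 /= cj0 cj0'.
  by [].
rewrite /w; case: ifP => [/andP[]//|_]; by rewrite addr0.
Qed.

End Interface.

(** * Word length in the group *)

Section WordNorm.
Implicit Types u v g h : word gen.

Lemma word_norm_ex g : exists n, `[<exists h, size h = n /\ group_eq G_relators g h>].
Proof. by exists (size g); apply/asboolP; exists g; split=> //; apply: weq_refl. Qed.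

Definition word_norm g : nat := ex_minn (word_norm_ex g).

Lemma word_norm_attained g : exists h, size h = word_norm g /\ group_eq G_relators g h.
Proof. by rewrite /word_norm; case: ex_minnP => n /asboolP. Qed.

Lemma word_norm_le g h : group_eq G_relators g h -> (word_norm g <= size h)%N.
Proof.
rewrite /word_norm => gh; case: ex_minnP => n _; apply.
by apply/asboolP; exists h.
Qed.

Lemma word_norm_eq g h : group_eq G_relators g h -> word_norm g = word_norm h.
Proof.
move=> gh; apply/eqP; rewrite eqn_leq.
have [g' [sg gg']] := word_norm_attained g.
have [h' [sh hh']] := word_norm_attained h.
rewrite -{1}sh -{2}sg; apply/andP.
by split; apply: word_norm_le; rewrite ?gh // -gh.
Qed.

Lemma word_norm_cat g h : (word_norm (g ++ h) <= word_norm g + size h)%N.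
Proof.
have [g' [sg gg']] := word_norm_attained g.
rewrite -sg -size_cat; apply: word_norm_le; rewrite gg'; exact: weq_refl.
Qed.

Definition word_within (r : nat) g h : Prop :=
  exists u, (size u <= r)%N /\ group_eq G_relators h (g ++ u).

Lemma word_within_refl r g : word_within r g g.
Proof. by exists [::]; rewrite cats0; split=> //; apply: weq_refl. Qed.

Lemma word_within_sym r g h : word_within r g h -> word_within r h g.
Proof.
move=> [u [ur gh]]; exists (winv u); rewrite size_winv; split=> //.
by rewrite gh -catA weq_winvr cats0; apply: weq_refl.
Qed.

Lemma word_within_trans r r' g h k :
  word_within r g h -> word_within r' h k -> word_within (r + r') g k.
Proof.
move=> [u [ur gh]] [v [vr hk]]; exists (u ++ v); rewrite size_cat leq_add //.
by split=> //; rewrite hk gh -catA; apply: weq_refl.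
Qed.

Lemma word_withinW r r' g h : (r <= r')%N -> word_within r g h -> word_within r' g h.
Proof. by move=> rr [u [ur gh]]; exists u; split=> //; apply: leq_trans rr. Qed.

Lemma word_within_norm g h : word_within (word_norm (winv g ++ h)) g h.
Proof.
have [u [su gu]] := word_norm_attained (winv g ++ h); exists u; split.
  by rewrite su.
by rewrite -gu catA weq_winvr; apply: weq_refl.
Qed.

End WordNorm.

Lemma fillable_group_eq A D u v : fillable A D u v -> group_eq G_relators u v.
Proof.
move=> [ps [rps uv _ _]]; apply: (@weq_catKr _ _ (winv v)); rewrite weq_winvr.
apply: weq_trans (weq_free _ uv) _ => {uv}.
elim: ps rps => [|[r x] ps IH] rps; first exact: weq_refl.
rewrite /conj_product /= -[flatten _]/(conj_product ps) IH /wconj; last first.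
  by move=> p pps; apply: rps; rewrite inE pps orbT.
have rel r' : r' \in G_relators -> weq (fun r => r \in G_relators) r' [::].
  by move=> rr; rewrite -[r']cats0; apply: (@weq_relator _ _ [::] [::]).
have -> : weq (fun r => r \in G_relators) r [::].
  case: (rps (r, x)) => [|/rel //|/= /rel rr]; first by rewrite inE eqxx.
  by rewrite -[r]winvK rr; apply: weq_refl.
rewrite cats0; exact: weq_winvl.
Qed.

(** * The loop and its pinching point *)

Section Loop.
Variable n : nat.

(** The theta part of an element is a vertex of the tree of the free group on theta1
    and theta2.  The loop runs twice through the elements over the vertex
    [theta1^n], at [k^n theta1^n] and at [theta1^n]; in between, it stays over the
    branch of the tree that starts there with the edge [theta2^-1].  Stacks being
    reversed words, these are the stacks with suffix [branch]. *)
Definition vertex : word bool := nseq n (false, false).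
Definition branch : word bool := (true, true) :: vertex.

Definition loop : word gen :=
  nseq n (gen_k, false) ++ nseq n (theta1, false) ++ nseq n (theta2, true) ++
  nseq n (gen_k, true) ++ nseq n (theta2, false) ++ nseq n (theta1, true).

Lemma size_loop : size loop = (6 * n)%N.
Proof. by rewrite /loop !size_cat !size_nseq; lia. Qed.

(** Both theta letters act in the same way on [k], so [theta1^n theta2^-n]
    commutes with it. *)
Lemma theta_quotient_comm m :
  group_eq G_relators
    (nseq m (gen_k, false) ++ nseq n (theta1, false) ++ nseq n (theta2, true))
    ((nseq n (theta1, false) ++ nseq n (theta2, true)) ++ nseq m (gen_k, false)).
Proof.
have winv_nseq i (l : gen * bool) : winv (nseq i l) = nseq i (linv l).
  by rewrite /winv map_nseq rev_nseq.
have conj t : is_theta t -> group_eq G_relators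
    (nseq n t ++ [:: (gen_k, false)] ++ nseq n (linv t))
    ((gen_k, false) :: apow (- tsum (nseq n t))).
  move=> tt; have ut : all is_theta (nseq n t) by rewrite all_nseq tt orbT.
  by have := fillable_group_eq (fillable_conj_k 0 ut); rewrite sub0r winv_nseq.
have sumE : tsum (nseq n (theta1, true)) = tsum (nseq n (theta2, true)).
  by elim: (n) => // i IH; rewrite /= !tsum_cons IH.
have := conj (theta1, true) isT; rewrite sumE => /weq_trans.
move=> /(_ _ (weq_sym (conj (theta2, true) isT))).
rewrite /linv /= => cc.
set c1 := nseq n (theta1, false) in cc *; set C2 := nseq n (theta2, true) in cc *.
have c1K : winv c1 = nseq n (theta1, true) by rewrite winv_nseq.
have C2K : winv C2 = nseq n (theta2, false) by rewrite winv_nseq.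
rewrite -c1K -C2K in cc.
have comm1 : group_eq G_relators ([:: (gen_k, false)] ++ c1 ++ C2)
    ((c1 ++ C2) ++ [:: (gen_k, false)]).
  apply: (@weq_catK _ _ (winv c1)); apply: (@weq_catKr _ _ (winv C2)).
  rewrite -!catA (catA (winv c1) c1) weq_winvl weq_winvr cats0 cc.
  exact: weq_refl.
elim: m => [|m IH]; first by rewrite cats0; apply: weq_refl.
rewrite -[nseq m.+1 _]/([:: (gen_k, false)] ++ nseq m (gen_k, false)).
rewrite -catA IH (catA [:: (gen_k, false)]) comm1 -!catA; exact: weq_refl.
Qed.

End Loop.
Section TreeCut.
Variable n : nat.
Let v := vertex n.
Let b := branch n.

Lemma suffix_branch_cons t s : suffix b (t :: s) = (b == t :: s) || suffix b s.
Proof.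
apply/idP/idP => [/suffixP[[|y p]]|/orP[/eqP ->|]].
- by move=> /= ->; rewrite eqxx.
- by move=> [_ ->]; rewrite suffix_suffix orbT.
- exact: suffix_refl.
- by move=> bs; rewrite -cat1s suffix_catr.
Qed.

Lemma suffix_branch_push t s :
  suffix b (tpush t s) != suffix b s -> s = v \/ tpush t s = v.
Proof.
have cons_case t' s' : suffix b (t' :: s') != suffix b s' -> s' = v.
  rewrite suffix_branch_cons; case: (eqVneq b (t' :: s')) => [[_ <-] //|_].
  by rewrite eqxx.
case: s => [|t' s] /=; first by move=> /cons_case; left.
case: ifP => _; last by move=> /cons_case; left.
by rewrite eq_sym => /cons_case; right.
Qed.

(** A path in the tree can enter or leave the branch only through [v]. *)
Lemma branch_crossing s (h : word gen) : suffix b (trun s h) != suffix b s ->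
  exists h1 h2, h = h1 ++ h2 /\ trun s h1 = v.
Proof.
elim: h s => [|l h IH] s; first by rewrite eqxx.
case: (eqVneq (suffix b (tstep s l)) (suffix b s)) => [sE|sl] H.
  rewrite -sE in H; have [h1 [h2 [-> h1v]]] := IH _ H.
  by exists (l :: h1), h2.
have : s = v \/ tstep s l = v.
  by move: sl; case: (l) => [[] c]; rewrite ?eqxx //; apply: suffix_branch_push.
case=> [->|lv]; first by exists [::], (l :: h).
by exists [:: l], h.
Qed.

Lemma krun_fibre x : trun [::] x = v -> (krun (- n%:Z, 0, [::]) x).1.1 = 0.
Proof.
move=> xv; rewrite krun_tsum.
pose ssum (s : word bool) : int := \sum_(t <- s) sgz_of t.2.
have push t s : ssum (tpush t s) = sgz_of t.2 + ssum s.
  case: s => [|t' s]; first by rewrite /ssum /= big_seq1 big_nil addr0.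
  rewrite /tpush; case: (eqVneq t' (linv t)) => [->|_]; last by rewrite /ssum big_cons.
  by rewrite {2}/ssum big_cons /=; case: (t.2) => /=; rewrite -/(ssum s); ring.
have H s w : ssum (trun s w) = ssum s + tsum w.
  elim: w s => [|l w IH] s; first by rewrite /tsum big_nil addr0.
  rewrite /trun /= -/(trun _ w) IH tsum_cons addrA; congr (_ + _).
  by case: l => [[] c]; rewrite /= ?addr0 // push /= addrC.
have := H [::] x; rewrite xv /ssum big_nil add0r => <-.
rewrite /v /vertex big_nseq_cond /= iter_addr addr0.
by rewrite -mulr_natr mul1r natz addNr.
Qed.

(** Over the vertex [theta1^n] the exponent sum is [n]; starting at [-n] makes it
    vanish there, and turns [k^n theta1^n] into [(k a^n)^n], with [n.-1] long runs. *)
Definition fibre_runs r (x : word gen) : nat :=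
  long_runs r (krun (- n%:Z, 0, [::]) x).2.

Lemma fibre_runs_within r r' x y : (2 * r' <= r)%N ->
    trun [::] x = v -> trun [::] y = v -> word_within r' x y ->
  (fibre_runs r x <= (fibre_runs r y).+1)%N.
Proof.
move=> rr xv yv [h [hr' yE]]; rewrite /fibre_runs.
have ky : krun (- n%:Z, 0, [::]) y = krun (krun (- n%:Z, 0, [::]) x) h.
  by rewrite (krun_group_eq _ yE) // /krun foldl_cat.
have := krun_fibre xv; have := krun_fibre yv; rewrite ky.
case: (krun (- _, _, _) x) => [[e0 m0] s0] /= + e00; rewrite {}e00.
case E: (krun _ h) => [[e1 m1] s1] /= e10; rewrite {}e10 in E.
by apply: long_runs_krun E; apply: leq_trans rr; rewrite leq_mul.
Qed.

End TreeCut.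

Section LoopRun.
Variable n : nat.

Lemma winv_nseq (X : Type) i (l : X * bool) : winv (nseq i l) = nseq i (linv l).
Proof. by rewrite /winv map_nseq rev_nseq. Qed.

Lemma foldl_cat_trun s u w : trun s (u ++ w) = trun (trun s u) w.
Proof. exact: foldl_cat. Qed.

Lemma trun_nseqS s m l : trun s (nseq m.+1 l) = trun (tstep s l) (nseq m l).
Proof. by []. Qed.

Lemma trun_k s m c : trun s (nseq m (gen_k, c)) = s.
Proof. by elim: m. Qed.

Lemma trun_theta1 m i :
  trun (nseq i (false, false)) (nseq m (theta1, false)) = nseq (m + i) (false, false).
Proof.
elim: m i => // m IH i; rewrite addSnnS -IH trun_nseqS; congr (trun _ _).
by case: i.
Qed.

Lemma trun_down m i :
  trun (nseq i (true, true) ++ vertex n) (nseq m (theta2, true)) =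
  nseq (m + i) (true, true) ++ vertex n.
Proof.
elim: m i => // m IH i; rewrite addSnnS -IH trun_nseqS; congr (trun _ _).
by case: i => //=; rewrite /vertex; case: n.
Qed.

Lemma trun_up m i : (m <= i)%N ->
  trun (nseq i (true, true) ++ vertex n) (nseq m (theta2, false)) =
  nseq (i - m) (true, true) ++ vertex n.
Proof.
elim: m i => [|m IH] i; first by rewrite subn0.
by case: i => // i mi; rewrite subSS -IH // trun_nseqS.
Qed.

Lemma suffix_branch_nseq i : (0 < i)%N ->
  suffix (branch n) (nseq i (true, true) ++ vertex n).
Proof.
by case: i => // i _; rewrite -addn1 nseqD -catA suffix_suffix.
Qed.

Lemma trun_no_theta2 s (w : word gen) :
  all (fun t : bool * bool => ~~ t.1) s ->
  all (fun l => if l.1 is theta2 then false else true) w ->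
  suffix (branch n) (trun s w) = false.
Proof.
move=> sF wF; set P := (fun t : bool * bool => _) in sF.
have pushF t s' : P t -> all P s' -> all P (tpush t s').
  case: s' => [|t' s'] tF sF'; first by rewrite /= tF.
  rewrite /tpush; case: ifP => _; first by case/andP: sF'.
  by rewrite [all _ _]/= -[X in _ && X]/(all P (t' :: s')) tF.
have : all P (trun s w).
  elim: w s sF wF => // -[x c] w IH s sF /andP wF; apply: IH (proj2 wF).
  by case: x wF => -[// _ _]; apply: pushF.
move=> H; apply/negP => /suffixP[p pE]; move: H; rewrite pE all_cat.
by rewrite /branch /= andbF.
Qed.

Let A := nseq n (gen_k, false).
Let B := nseq n (theta1, false).
Let C := nseq n (theta2, true).
Let D := nseq n (gen_k, true).
Let E := nseq n (theta2, false).
Let F := nseq n (theta1, true).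

Let take_nseqE (l : gen * bool) q : (q <= n)%N -> take q (nseq n l) = nseq q l.
Proof. by move=> qn; rewrite -(subnKC qn) nseqD take_size_cat // size_nseq. Qed.

Lemma take_loop2 : take (2 * n) (loop n) = A ++ B.
Proof. by rewrite /loop catA take_size_cat // size_cat !size_nseq; lia. Qed.

Lemma take_loop5 : take (5 * n) (loop n) = A ++ B ++ C ++ D ++ E.
Proof.
by rewrite /loop -/A -/B -/C -/D -/E -/F !catA take_size_cat //= !size_cat !size_nseq; lia.
Qed.

Lemma trun_AB : trun [::] (A ++ B) = vertex n.
Proof. by rewrite foldl_cat_trun trun_k (trun_theta1 n 0) addn0. Qed.

Lemma trun_ABCDE : trun [::] (A ++ B ++ C ++ D ++ E) = vertex n.
Proof.
rewrite catA foldl_cat_trun trun_AB !foldl_cat_trun (trun_down n 0) trun_k addn0.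
by rewrite trun_up // subnn.
Qed.

Lemma loop_color p :
  suffix (branch n) (trun [::] (take p (loop n))) = (2 * n < p < 5 * n)%N.
Proof.
have AB_F q : all (fun l => if l.1 is theta2 then false else true) (take q (A ++ B)).
  apply/allP => l /mem_take; rewrite mem_cat => /orP[] /nseqP[-> _] //.
have [p2|p2] := leqP p (2 * n).
  rewrite /loop catA takel_cat; last by rewrite size_cat !size_nseq; lia.
  exact: trun_no_theta2.
have [p5|p5] := ltnP p (5 * n); last first.
  have -> : take p (loop n) = (A ++ B ++ C ++ D ++ E) ++ take (p - 5 * n) F.
    rewrite /loop -/A -/B -/C -/D -/E -/F !catA take_cat ltnNge.
    have -> : size ((((A ++ B) ++ C) ++ D) ++ E) = (5 * n)%N.
      by rewrite !size_cat !size_nseq; lia.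
    by rewrite p5.
  rewrite foldl_cat_trun trun_ABCDE; apply: trun_no_theta2.
    by apply/allP => t /nseqP[-> _].
  by apply/allP => l /mem_take /nseqP[-> _].
have [q qE] : exists q, p = (2 * n + q)%N by exists (p - 2 * n)%N; lia.
have AB2 : size (A ++ B) = (2 * n)%N by rewrite size_cat !size_nseq; lia.
have -> : take p (loop n) = (A ++ B) ++ take q (C ++ D ++ E ++ F).
  rewrite /loop -/A -/B -/C -/D -/E -/F catA take_cat AB2 ltnNge (ltnW p2) /=.
  by rewrite qE addKn.
rewrite foldl_cat_trun trun_AB.
have [qn|qn] := leqP q n.
  rewrite takel_cat ?size_nseq // take_nseqE // (trun_down q 0) addn0.
  by apply: suffix_branch_nseq; lia.
have [q2|q2] := leqP q (2 * n).
  rewrite take_cat size_nseq ltnNge (ltnW qn) /= takel_cat ?size_nseq; last lia.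
  rewrite take_nseqE; last lia.
  rewrite foldl_cat_trun (trun_down n 0) trun_k addn0.
  by apply: suffix_branch_nseq; lia.
rewrite catA take_cat size_cat !size_nseq.
have -> : (q < n + n)%N = false by lia.
rewrite takel_cat ?size_nseq; last lia.
rewrite take_nseqE; last lia.
rewrite !foldl_cat_trun (trun_down n 0) trun_k addn0 trun_up; last lia.
by apply: suffix_branch_nseq; lia.
Qed.

Lemma krun_theta1 e m s i :
  krun (e, m, s) (nseq i (theta1, false)) = (e + i%:Z, m, s).
Proof.
elim: i e => [|i IH] e; first by rewrite addr0.
by rewrite /krun /= -/(krun _ _) IH -addrA -PoszD.
Qed.

Lemma fibre_runs_start r : (r < n)%N -> fibre_runs n r (A ++ B) = n.-1.
Proof.
move=> rn; rewrite /fibre_runs /krun foldl_cat -!/(krun _ _).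
have kpush m s i : (if s is (c, _) :: _ then c = false else True) ->
    krun (- n%:Z, m, s) (nseq i.+1 (gen_k, false)) =
    (- n%:Z, n%:Z, nseq i (false, n%:Z) ++ (false, m) :: s).
  elim: i m s => [|i IH] m s sF.
    by rewrite /krun; case: s sF => [_|[c w] s /= ->]; rewrite /= ?opprK.
  rewrite -[nseq i.+2 _]/((gen_k, false) :: nseq i.+1 (gen_k, false)).
  have -> : krun (- n%:Z, m, s) ((gen_k, false) :: nseq i.+1 (gen_k, false)) =
      krun (- n%:Z, n%:Z, (false, m) :: s) (nseq i.+1 (gen_k, false)).
    by rewrite /krun; case: s sF => [_|[c w] s /= ->]; rewrite /= ?opprK.
  by rewrite IH // -[in RHS]addn1 nseqD -catA.
have n0 : n = n.-1.+1 by lia.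
rewrite /A {2}n0 kpush // krun_theta1 /long_runs /= count_cat count_nseq /=.
have -> : r%:Z < `|n%:Z| by lia.
by rewrite mul1n /= !addn0.
Qed.

Lemma fibre_runs_end r : fibre_runs n r (A ++ B ++ C ++ D ++ E) = 0%N.
Proof.
have ABCDE : group_eq G_relators (A ++ B ++ C ++ D ++ E) B.
  have -> : A ++ B ++ C ++ D ++ E = (A ++ B ++ C) ++ D ++ E by rewrite -!catA.
  have -> : D = winv A by rewrite /A winv_nseq.
  have -> : E = winv C by rewrite /C winv_nseq.
  rewrite (theta_quotient_comm n n) -!catA (catA (nseq n (gen_k, false))) weq_winvr.
  rewrite cat0s weq_winvr cats0; exact: weq_refl.
by rewrite /fibre_runs (krun_group_eq _ ABCDE) // krun_theta1.
Qed.

Lemma loop_trivial : group_eq G_relators (loop n) [::].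
Proof.
rewrite /loop -/A -/B -/C -/D -/E -/F.
have -> : A ++ B ++ C ++ D ++ E ++ F = (A ++ B ++ C) ++ D ++ E ++ F by rewrite -!catA.
have -> : D = winv A by rewrite /A winv_nseq.
have -> : E = winv C by rewrite /C winv_nseq.
have -> : F = winv B by rewrite /B winv_nseq.
rewrite (theta_quotient_comm n n) -!catA (catA (nseq n (gen_k, false))) weq_winvr.
rewrite cat0s (catA C) weq_winvr weq_winvr; exact: weq_refl.
Qed.

End LoopRun.

Section Filling.
Variables (n r K : nat) (g : nat -> nat -> word gen).
Let N := (6 * K)%N.

Let col i j := suffix (branch n) (trun [::] (g i j)).

Hypothesis g_h : forall i j, (i <= N)%N -> (j < N)%N -> word_within r (g i j) (g i j.+1).
Hypothesis g_v : forall i j, (i < N)%N -> (j <= N)%N -> word_within r (g i j) (g i.+1 j).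

Let g2 (x : nat * nat) := g x.1 x.2.

Definition crosses (e : grid_edge N) x :=
  trun [::] x = vertex n /\ word_within r (g2 (esrc e)) x.

Lemma crossing_point (a : 'I_N * 'I_N) e : on_square a e ->
  bicolored col e -> exists x, crosses e x.
Proof.
move=> ae be.
have [h [hr tE]] : word_within r (g2 (esrc e)) (g2 (etgt e)).
  case/andP: ae => _; case: e {be} => d [i j] /andP[/= iN jN].
  have := ltn_ord i; have := ltn_ord j; have := ltn_ord a.1; have := ltn_ord a.2.
  by case: d iN jN => /= iN jN a2 a1 jN' iN'; [apply: g_v|apply: g_h]; rewrite /=; lia.
move: be; rewrite /bicolored /col2 /col -!/(g2 _) (trun_group_eq _ tE) //.
rewrite foldl_cat_trun eq_sym => /branch_crossing[h1 [h2 [hE h1v]]].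
exists (g2 (esrc e) ++ h1); split; first by rewrite foldl_cat_trun.
exists h1; split; last exact: weq_refl.
by apply: leq_trans hr; rewrite hE size_cat leq_addr.
Qed.

Lemma within_square (a : 'I_N * 'I_N) x y : in_square a x -> in_square a y ->
  word_within (r + r) (g2 x) (g2 y).
Proof.
case: a => a b; have := ltn_ord a; have := ltn_ord b.
case: x y => [i j] [i' j'] bN aN /andP[/= ai bj] /andP[/= ai' bj'].
rewrite /g2 /=; apply: (@word_within_trans r r _ (g i' j)).
  have [->|ii] := eqVneq i i'; first exact: (word_within_refl _ _).
  have [lt|ge] := ltnP i i'.
    by have -> : i' = i.+1 by [lia]; apply: g_v; lia.
  by apply: word_within_sym; have -> : i = i'.+1 by [lia]; apply: g_v; lia.
have [->|jj] := eqVneq j j'; first exact: (word_within_refl _ _).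
have [lt|ge] := ltnP j j'.
  by have -> : j' = j.+1 by [lia]; apply: g_h; lia.
by apply: word_within_sym; have -> : j = j'.+1 by [lia]; apply: g_h; lia.
Qed.

(** Neighbouring crossing points lie in the fibre over the pinching point at
    distance at most [4 * r], so the number of long runs can only decrease by
    one at each step along the interface. *)
Lemma fibre_runs_path e p x y : path (interface_adj col) e p ->
    crosses e x -> crosses (last e p) y ->
  (fibre_runs n (8 * r) x <= fibre_runs n (8 * r) y + (size p).+1)%N.
Proof.
elim: p e x => [|f p IH] e x.
  move=> _ [xv ex] [yv ey]; rewrite addn1.
  apply: (@fibre_runs_within _ _ (r + r)) => //; first by lia.
  exact: word_within_trans (word_within_sym ex) ey.
move=> /= /andP[/and3P[_ bf /existsP[a /andP[ae af]]] fp] [xv ex] cy.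
have [z cz] := crossing_point af bf; have [zv fz] := cz.
have xz : (fibre_runs n (8 * r) x <= (fibre_runs n (8 * r) z).+1)%N.
  apply: (@fibre_runs_within _ _ (r + (r + r) + r)) => //; first by lia.
  apply: word_within_trans fz; apply: word_within_trans (word_within_sym ex) _.
  by case/andP: ae => ae _; case/andP: af => af _; apply: within_square af.
by apply: leq_trans xz _; rewrite addnS ltnS; apply: IH fp cz cy.
Qed.

Hypothesis K0 : (0 < K)%N.
Hypothesis Kn : (K <= n)%N.
Hypothesis nKr : (n %/ K < r)%N.
Hypothesis rn : (8 * r < n)%N.
Hypothesis Nn : (2 * N.+1 ^ 2 + 1 < n)%N.
Hypothesis g_loop : forall j, (j <= N)%N -> g 0 j = take ((n * j) %/ K) (loop n).
Hypothesis g_top : forall j, (j <= N)%N -> g N j = [::].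
Hypothesis g_side : forall i, (0 < i)%N -> (i <= N)%N -> g i 0 = [::] /\ g i N = [::].

(** The colour of a grid point tells whether it lies over the branch.  The two
    colour changes on the side of the loop are joined by an interface, hence
    [k^n theta1^n], with [n.-1] long runs, and [theta1^n], with none, are joined by
    fewer than [n.-1] steps of length at most [4 * r] in the fibre. *)
Lemma coarse_filling_false : False.
Proof.
have N0 : (0 < N)%N by rewrite /N; lia.
have col0 j : (j <= N)%N -> col 0 j = (2 * K < j < 5 * K)%N.
  move=> jN; rewrite /col g_loop // loop_color ltn_divLR // leq_divRL //.
  by congr (_ && _); apply/idP/idP; nia.
have colF i j : g i j = [::] -> col i j = false.
  by rewrite /col => ->; rewrite suffixs0.
have e0e1 : connect (interface_adj col) (grid_edge_of N false 0 (2 * K))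
    (grid_edge_of N false 0 (5 * K).-1).
  apply: interface_connect; rewrite ?col0 /N; try by [lia].
  - by move=> j jN; apply/colF/g_top.
  - by move=> i i0 iN; have [? ?] := g_side i0 iN; split; apply: colF.
  - move=> j jN; rewrite !col0 //; last exact: ltnW.
    have [->|jK] := eqVneq j (2 * K)%N; first by left.
    have [->|jK'] := eqVneq j (5 * K).-1; first by right.
    move=> /eqP H; exfalso; apply: H; apply/idP/idP; lia.
have /connectP[p0 pp0 lp0] := e0e1.
move: lp0; case/shortenP: pp0 => p pp up _ lp.
have sp : (size p < 2 * N.+1 ^ 2)%N.
  have := card_uniqP up => /= <-.
  by apply: leq_trans (max_card _) _; rewrite !card_prod card_bool !card_ord mulnn.
have c0 : crosses (grid_edge_of N false 0 (2 * K))
    (nseq n (gen_k, false) ++ nseq n (theta1, false)).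
  split; first exact: trun_AB.
  rewrite /g2 /esrc /= !inordK; try by rewrite /N; lia.
  rewrite g_loop; last by rewrite /N; lia.
  have -> : (n * (2 * K) %/ K = 2 * n)%N by rewrite mulnA mulnK // mulnC.
  rewrite take_loop2; exact: word_within_refl.
have c1 : crosses (last (grid_edge_of N false 0 (2 * K)) p)
    (take (5 * n) (loop n)).
  rewrite -lp; split; first by rewrite take_loop5 trun_ABCDE.
  rewrite /g2 /esrc /= !inordK; try by rewrite /N; lia.
  rewrite g_loop; last by rewrite /N; lia.
  set q := (_ %/ K)%N.
  have q5 : (q <= 5 * n)%N.
    have <- : (n * (5 * K) %/ K = 5 * n)%N by rewrite mulnA mulnK // mulnC.
    by rewrite leq_div2r // leq_mul2l leq_pred orbT.
  exists (drop q (take (5 * n) (loop n))); split.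
    rewrite size_drop size_takel ?size_loop; last by lia.
    have := ltn_ceil n K0; have : (5 * n - (n %/ K).+1 <= q)%N.
      rewrite /q leq_divRL // -subn1 mulnBr muln1 mulnBl.
      by have := ltn_ceil n K0; rewrite mulnCA mulnA; lia.
    lia.
  rewrite -(take_takel _ q5) cat_take_drop; exact: weq_refl.
have := fibre_runs_path pp c0 c1.
rewrite take_loop5 fibre_runs_end fibre_runs_start //.
have bound a M : (a < M -> M + 1 < n -> n.-1 <= 0 + a.+1 -> False)%N by lia.
exact: bound sp Nn.
Qed.

End Filling.

(** * Grids from null-homotopies in an asymptotic cone *)

Lemma square_uniform_continuity (R : realType) (T : metricType R) (H : R * R -> T) :
    {within `[0, 1]%classic `*` `[0, 1]%classic, continuous H} ->
  forall e : R, 0 < e -> exists2 s : R, 0 < s &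
    forall x y : R * R, (`[0, 1]%classic `*` `[0, 1]%classic) x ->
      (`[0, 1]%classic `*` `[0, 1]%classic) y ->
      `|x.1 - y.1| < s -> `|x.2 - y.2| < s -> mdist (H x) (H y) < e.
Proof.
set Q : set (R * R) := _ `*` _; move=> /subspace_continuousP cH e e0.
have cQ : compact Q by apply: compact_setX; exact: segment_compact.
pose P (s : R) (x : R * R) := forall y, Q y ->
  `|x.1 - y.1| < s -> `|x.2 - y.2| < s -> mdist (H x) (H y) < e.
have /compact_near_coveringP/near_covering_withinP/(_ R (0^'+) P _) := cQ.
case=> [x Qx|s0 /= s00 sP].
  have e20 : 0 < e / 2 by rewrite divr_gt0.
  have /metricType_numDomainType.cvgrPdist_lt/(_ _ e20) := cH x Qx.
  rewrite near_withinE => /nbhs_ballP[c /= c0 cP].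
  have c20 : 0 < c / 2 by rewrite divr_gt0.
  exists (ball x (c / 2), [set s | s < c / 2]) => /=.
    by split; [exact: nbhsx_ballx|exact: nbhs_right_lt].
  move=> [x' s] /= [[bx1 bx2] sc] Qx' y Qy d1 d2.
  rewrite /ball /= in bx1 bx2.
  have Hx' : mdist (H x) (H x') < e / 2.
    apply: cP => //; split; rewrite /ball /=; first apply: lt_trans bx1 _;
      last apply: lt_trans bx2 _; lra.
  have Hy : mdist (H x) (H y) < e / 2.
    apply: cP => //; split; rewrite /ball /=.
      have := ler_distD x'.1 x.1 y.1; lra.
    have := ler_distD x'.2 x.2 y.2; lra.
  by have := metric_triangle (H x') (H x) (H y); rewrite (metric_sym (H x') (H x)); lra.
pose s := s0 / 2; have s_gt0 : 0 < s by rewrite divr_gt0.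
exists s => // x y Qx; apply: (sP s) => //=.
by rewrite sub0r normrN gtr0_norm // /s; lra.
Qed.

Lemma homotopy_grid (R : realType) (T : metricType R) (p : R -> T) :
    null_homotopic p -> p 0 = p 1 -> forall e : R, 0 < e ->
  exists N0, forall N, (N0 <= N)%N -> (0 < N)%N -> exists F : nat -> nat -> T,
    [/\ forall j, (j <= N)%N -> F 0 j = p (j%:R / N%:R),
        forall j, (j <= N)%N -> F N j = p 0,
        forall i, (i <= N)%N -> F i 0 = p 0 /\ F i N = p 0,
        forall i j, (i <= N)%N -> (j < N)%N -> mdist (F i j) (F i j.+1) < e &
        forall i j, (i < N)%N -> (j <= N)%N -> mdist (F i j) (F i.+1 j) < e].
Proof.
move=> [H [cH HP]] p01 e e0.
have [s s0 sP] := square_uniform_continuity cH e0.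
exists (Num.bound s^-1) => N NN N0.
have N0R : 0 < N%:R :> R by rewrite ltr0n.
have Ns : N%:R^-1 < s.
  rewrite -(invrK s) ltf_pV2 ?posrE ?invr_gt0 //.
  have s1 : 0 <= s^-1 by rewrite invr_ge0 ltW.
  by apply: lt_le_trans (archi_boundP s1) _; rewrite ler_nat.
have unit i : (i <= N)%N -> `[0, 1]%classic (i%:R / N%:R : R).
  move=> iN; rewrite /= in_itv /= divr_ge0 ?ler0n // ler_pdivrMr // mul1r.
  by rewrite ler_nat.
have unitP i : (i <= N)%N -> (i%:R / N%:R : R) \in `[0, 1].
  by move=> /unit; rewrite /= inE.
have z1 : N%:R / N%:R = 1 :> R by rewrite divff // gt_eqF.
exists (fun i j => H (i%:R / N%:R, j%:R / N%:R)); split.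
- by move=> j jN; rewrite mul0r; case: (HP _ (unitP j jN)).
- by move=> j jN; rewrite z1; case: (HP _ (unitP j jN)).
- by move=> i iN; rewrite z1 mul0r; case: (HP _ (unitP i iN)).
- move=> i j iN jN; apply: sP; [|split=> /=|..]; rewrite /= ?subrr ?normr0 //.
  + by split; apply: unit => //; apply: ltnW.
  + exact: unit.
  + exact: unit.
  + rewrite -mulrBl -opprB -natrB // subSnn mulN1r normrN gtr0_norm ?invr_gt0 //.
- move=> i j iN jN; apply: sP; [|split=> /=|..]; rewrite /= ?subrr ?normr0 //.
  + by split; apply: unit => //; apply: ltnW.
  + exact: unit.
  + exact: unit.
  + rewrite -mulrBl -opprB -natrB // subSnn mulN1r normrN gtr0_norm ?invr_gt0 //.
Qed.

Section ConePaths.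
Variables (R : realType) (X : metricType R).
Variables (omega : set_system nat) (ultra : UltraFilter omega).
Variables (o : nat -> X) (d : nat -> R) (d_gt0 : forall n, 0 < d n).
Let D := cone_pseudodist ultra o d_gt0.
Let omega_proper : ProperFilter omega := @ultra_proper _ _ ultra.
Local Existing Instance omega_proper.

Lemma cone_seq_of_bounded (x : nat -> X) (M : R) :
  (forall n, mdist (o n) (x n) / d n <= M) ->
  (limn_esup (fun i => (mdist (o i) (x i) / d i)%:E) < +oo)%E.
Proof.
move=> xM; apply: le_lt_trans (_ : M%:E < +oo)%E; last exact: ltry.
apply: (@le_trans _ _ (ereal_sup
  [set (mdist (o i) (x i) / d i)%:E | i in [set: nat]])).
  by apply: ereal_inf_lbound; exists [set: nat] => //; apply: filterT.
by apply: ge_ereal_sup => _ [n _ <-]; rewrite lee_fin.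
Qed.

Lemma cone_dist_le (x y : cone_seq o d) (B : R) :
  (forall e, 0 < e ->
     \forall n \near omega, mdist (val x n) (val y n) / d n <= B + e) ->
  cone_dist omega x y <= B.
Proof.
move=> H; apply/ler_addgt0Pr => e e0.
by apply: limr_le; [exact: cone_dist_cvg|exact: H].
Qed.

Lemma cone_dist_lt (x y : cone_seq o d) (B : R) : cone_dist omega x y < B ->
  \forall n \near omega, mdist (val x n) (val y n) < B * d n.
Proof.
move=> xyB; have := @cvgr_lt R nat omega _ _ _
  (cone_dist_cvg ultra d_gt0 (x := x) (y := y)) B xyB.
by move=> /(_ _); apply: filterS => n; rewrite ltr_pdivrMr.
Qed.

Lemma cone_mdistE (x y : cone_seq o d) :
  mdist (mq_proj D x : asymptotic_cone ultra o d_gt0) (mq_proj D y) =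
  cone_dist omega x y.
Proof. exact: (mq_distE D). Qed.

Lemma lipschitz_is_path (Q : R -> cone_seq o d) (C : R) :
  (forall s t, cone_dist omega (Q s) (Q t) <= C * `|s - t|) ->
  is_path (fun t => mq_proj D (Q t) : asymptotic_cone ultra o d_gt0).
Proof.
move=> QC; apply: continuous_subspaceT => t.
apply/metricType_numDomainType.cvgrPdist_lt => e e0.
have C0 : 0 <= C.
  have := QC 0 1; rewrite sub0r normrN normr1 mulr1; apply: le_trans.
  exact: (pdist_ge0 D).
have C1 : 0 < C + 1 by rewrite ltr_wpDl.
near=> s.
rewrite cone_mdistE; apply: le_lt_trans (QC t s) _.
apply: (@le_lt_trans _ _ ((C + 1) * `|t - s|)).
  by rewrite ler_wpM2r // lerDl.
rewrite mulrC -ltr_pdivlMr //.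
near: s; apply/nbhs_ballP; exists (e / (C + 1)) => //=; exact: divr_gt0.
Unshelve. all: by end_near. Qed.

(** Away from the side carrying the loop any representatives of the points of
    the homotopy will do; on that side the given ones are kept, so that the loop
    can be followed exactly in almost every rescaled space. *)
Lemma cone_grid (Q : R -> cone_seq o d) :
    simply_connected R (asymptotic_cone ultra o d_gt0) ->
    is_path (fun t => mq_proj D (Q t) : asymptotic_cone ultra o d_gt0) ->
    cone_dist omega (Q 0) (Q 1) = 0 ->
  forall e : R, 0 < e -> exists N0, forall N, (N0 <= N)%N -> (0 < N)%N ->
    \forall n \near omega, exists f : nat -> nat -> X,
    [/\ forall j, (j <= N)%N -> f 0 j = val (Q (j%:R / N%:R)) n,
        forall j, (j <= N)%N -> f N j = val (Q 0) n,
        forall i, (0 < i)%N -> (i <= N)%N ->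
          f i 0 = val (Q 0) n /\ f i N = val (Q 0) n,
        forall i j, (i <= N)%N -> (j < N)%N ->
          mdist (f i j) (f i j.+1) < e * d n &
        forall i j, (i < N)%N -> (j <= N)%N ->
          mdist (f i j) (f i.+1 j) < e * d n].
Proof.
set p := (fun t : R => _) => -[_ sc] pp Q01 e e0.
have p01 : p 0 = p 1.
  by apply: (@mq_dist_positivity _ _ D); rewrite /p mq_distE.
have [N0 HN] := homotopy_grid (sc p pp p01) p01 e0.
exists N0 => N NN Npos; have [F [F0 FN Fs Fh Fv]] := HN N NN Npos.
pose G i j : cone_seq o d := if i == 0%N then Q (j%:R / N%:R)
  else if [|| i == N, j == 0%N | j == N] then Q 0 else repr (F i j).
have GF i j : (i <= N)%N -> (j <= N)%N -> mq_proj D (G i j) = F i j.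
  move=> iN jN; rewrite /G; case: eqP => [->|_]; first by rewrite F0.
  case: eqP => [->|_] /=; first by rewrite FN.
  case: eqP => [->|_] /=; first by case: (Fs i iN) => ->.
  case: eqP => [->|_] /=; first by case: (Fs i iN) => _ ->.
  exact: reprK.
have near_lt i j i' j' : (i <= N)%N -> (j <= N)%N -> (i' <= N)%N -> (j' <= N)%N ->
    mdist (F i j) (F i' j') < e ->
    \forall n \near omega, mdist (val (G i j) n) (val (G i' j') n) < e * d n.
  move=> iN jN i'N j'N; rewrite -!GF // => H; apply: cone_dist_lt.
  by rewrite -cone_mdistE.
have nh : \forall n \near omega, forall ij : 'I_N.+1 * 'I_N,
    mdist (val (G ij.1 ij.2) n) (val (G ij.1 ij.2.+1) n) < e * d n.
  apply: filter_forall => -[i j] /=; apply: near_lt => //.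
  - by rewrite -ltnS.
  - exact: ltnW.
  - by rewrite -ltnS.
  - by apply: Fh => //; rewrite -ltnS.
have nv : \forall n \near omega, forall ij : 'I_N * 'I_N.+1,
    mdist (val (G ij.1 ij.2) n) (val (G ij.1.+1 ij.2) n) < e * d n.
  apply: filter_forall => -[i j] /=; apply: near_lt => //.
  - exact: ltnW.
  - by rewrite -ltnS.
  - by rewrite -ltnS.
  - by apply: Fv => //; rewrite -ltnS.
apply: filterS2 nh nv => n nh nv.
exists (fun i j => val (G i j) n); split.
- by move=> j jN; rewrite /G eqxx.
- by move=> j jN; rewrite /G eqxx (gtn_eqF Npos).
- by move=> i i0 iN; rewrite /G !eqxx (gtn_eqF i0) !orbT.
- move=> i j iN jN; have iN' : (i < N.+1)%N by [].
  exact: (nh (Ordinal iN', Ordinal jN)).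
- move=> i j iN jN; have jN' : (j < N.+1)%N by [].
  exact: (nv (Ordinal iN, Ordinal jN')).
Qed.

End ConePaths.

(** * The metric of the Cayley graph and word length *)

Section CayleyMetric.
Variables (R : realType) (I : finType) (S : I -> word gen).
Hypothesis genS : generates G_relators S.
Notation point := (cayley_point R gen I).
Notation chain := (cayley_chain G_relators S).
Implicit Types (p q : point) (g h u : word gen).

Lemma cayley_dist_le p q (l : R) : chain p q l -> cayley_dist G_relators S p q <= l.
Proof.
by move=> pq; apply: ge_inf => //; exists 0 => l'; apply: cayley_chain_ge0.
Qed.

Lemma cayley_dist_chain p q (l : R) : cayley_dist G_relators S p q < l ->
  exists2 l', l' < l & chain p q l'.
Proof.
move=> pql; have e0 : 0 < l - cayley_dist G_relators S p q by rewrite subr_gt0.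
have hi : has_inf [set l | chain p q l].
  split; first by have [l' pq] := cayley_chain_connected genS p q; exists l'.
  by exists 0 => l'; apply: cayley_chain_ge0.
have [l' pq] := inf_adherent e0 hi.
by rewrite -/(cayley_dist _ _ p q) subrKC => ll; exists l'.
Qed.

Definition cayley_translate u p : point :=
  match p with
  | CVertex g => CVertex (u ++ g)
  | CEdge g i t => CEdge (u ++ g) i t
  end.

Lemma cayley_chain_translate u p q l :
  chain p q l -> chain (cayley_translate u p) (cayley_translate u q) l.
Proof.
elim=> /= [g h gh|g h i s t gh|g i s s0|g i s s1|p1 q1 l1 _|p1 q1 r1 l1 m1 _ + _].
- by apply: cchain_vertex; apply: weq_cat2l.
- by apply: cchain_edge; apply: weq_cat2l.
- exact: cchain_source.
- by rewrite catA; apply: cchain_target.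
- exact: cchain_sym.
- exact: cchain_trans.
Qed.

Lemma cayley_chain_word : exists2 C : R, 0 <= C &
  forall g h, exists2 l, chain (CVertex g) (CVertex (g ++ h)) l & l <= C * (size h)%:R.
Proof.
have step l : {c : R | chain (CVertex [::]) (CVertex [:: l]) c}.
  by apply: cid; apply: cayley_chain_connected.
pose c l := projT1 (step l); pose C := \sum_(l : gen * bool) c l.
have c0 l : 0 <= c l by apply: cayley_chain_ge0 (projT2 (step l)).
exists C; first by apply: sumr_ge0.
move=> g h; elim: h g => [|l h IH] g.
  exists 0; last by rewrite mulr0.
  by rewrite cats0; apply: cayley_chainxx.
have [m gm mC] := IH (g ++ [:: l]).
exists (c l + m).
  have := cayley_chain_translate g (projT2 (step l)); rewrite /= cats0 => gl.
  by apply: cchain_trans gl _; rewrite -catA in gm.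
have lC : c l <= C by rewrite /C (bigD1 l) //= lerDl sumr_ge0.
by rewrite /= -natr1 mulrDr mulr1 addrC lerD.
Qed.

Definition cayley_base p : word gen :=
  match p with CVertex g => g | CEdge g _ _ => g end.

Definition edge_bound : nat := \max_(i : I) size (S i).

Lemma size_gen_le i : (size (S i) <= edge_bound)%N.
Proof. exact: (@leq_bigmax _ (fun i => size (S i)) i). Qed.

(** A chain may consist of arbitrarily many short segments of edges, so rounding each
    of them to vertices would accumulate errors.  The word norm is therefore
    extended to the edges as a Lipschitz function. *)
Definition cayley_height g0 p : R :=
  match p with
  | CVertex g => (word_norm (winv g0 ++ g))%:R
  | CEdge g i t => (1 - val t) * (word_norm (winv g0 ++ g))%:R +
      val t * (word_norm (winv g0 ++ g ++ S i))%:R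
  end.

Lemma word_norm_step g i :
  `|(word_norm (g ++ S i))%:R - (word_norm g)%:R : R| <= edge_bound%:R.
Proof.
have Si := size_gen_le i.
have H1 : (word_norm (g ++ S i) <= word_norm g + edge_bound)%N.
  by apply: leq_trans (word_norm_cat _ _) _; rewrite leq_add2l.
have H2 : (word_norm g <= word_norm (g ++ S i) + edge_bound)%N.
  rewrite -(@word_norm_eq ((g ++ S i) ++ winv (S i)) g); last first.
    by rewrite -catA weq_winvr cats0; apply: weq_refl.
  by apply: leq_trans (word_norm_cat _ _) _; rewrite size_winv leq_add2l.
move: H1 H2; rewrite -!(ler_nat R) !natrD => H1 H2.
by rewrite ler_norml; apply/andP; split; lra.
Qed.

Lemma cayley_height_lipschitz g0 p q l : chain p q l ->
  `|cayley_height g0 p - cayley_height g0 q| <= edge_bound%:R * l.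
Proof.
elim=> /= [g h gh|g h i s t gh|g i s ->|g i s ->|p1 q1 l1 _|p1 q1 r1 l1 m1 _ + _].
- rewrite (@word_norm_eq (winv g0 ++ g) (winv g0 ++ h)) ?subrr ?normr0 ?mulr0 //.
  exact: weq_cat2l.
- rewrite (@word_norm_eq (winv g0 ++ h) (winv g0 ++ g)); last first.
    by apply: weq_cat2l; apply: weq_sym.
  rewrite (@word_norm_eq (winv g0 ++ h ++ S i) (winv g0 ++ g ++ S i)); last first.
    by apply: weq_cat2l; apply: weq_cat2r; apply: weq_sym.
  set x := (word_norm _)%:R; set y := (word_norm _)%:R.
  rewrite [X in `|X|](_ : _ = (val s - val t) * (y - x)); last by rewrite /=; ring.
  rewrite normrM mulrC ler_wpM2r //.
  by rewrite /y /x catA; apply: word_norm_step.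
- by rewrite subr0 mul1r mul0r addr0 subrr normr0 mulr0.
- by rewrite subrr mul0r mul1r add0r subrr normr0 mulr0.
- by rewrite distrC.
- move=> H1 H2; rewrite mulrDr; apply: le_trans (lerD H1 H2).
  exact: ler_distD.
Qed.

Lemma word_norm_chain p q (l : R) : chain p q l ->
  (word_norm (winv (cayley_base p) ++ cayley_base q))%:R <= edge_bound%:R * (l + 2).
Proof.
move=> pq; set g0 := cayley_base p.
have base r : `|cayley_height g0 r - (word_norm (winv g0 ++ cayley_base r))%:R|
    <= edge_bound%:R.
  case: r => [g|g i [t t01]] /=; first by rewrite subrr normr0.
  case/andP: t01 => t0 t1.
  rewrite [X in `|X|](_ : _ = t * ((word_norm (winv g0 ++ g ++ S i))%:R -
    (word_norm (winv g0 ++ g))%:R)); last by ring.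
  rewrite normrM (ger0_norm t0) -[leRHS]mul1r ler_pM //.
  by rewrite catA; apply: word_norm_step.
have p0 : word_norm (winv g0 ++ cayley_base p) = 0%N.
  apply/eqP; rewrite -leqn0; apply: (@word_norm_le _ [::]).
  exact: weq_winvl.
have := base p; have := base q; have := cayley_height_lipschitz g0 pq.
rewrite p0 subr0 !ler_norml => /andP[h1 _] /andP[h2 _] /andP[_ h3].
by rewrite mulrDr; lra.
Qed.

End CayleyMetric.

(** * Cones with unbounded scales *)

Section UnboundedScales.
Variables (R : realType) (I : finType) (S : I -> word gen).
Hypothesis genS : generates G_relators S.
Variables (omega : set_system nat) (ultra : UltraFilter omega).
Variables (d : nat -> R) (d_gt0 : forall n, 0 < d n).
Hypothesis d_ge0 : forall n, d 0 <= d n.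
Let X := cayley_graph R genS.
Let DC := cayley_pseudodist R genS.
Let o : nat -> X := fun=> cayley_identity R genS.
Let omega_proper : ProperFilter omega := @ultra_proper _ _ ultra.
Local Existing Instance omega_proper.

Lemma mdist_cayley (p q : cayley_point R gen I) :
  mdist (mq_proj DC p : X) (mq_proj DC q) = cayley_dist G_relators S p q.
Proof. exact: (mq_distE DC). Qed.

Lemma truncn_dist (x y : R) :
  `|(Num.truncn x)%:R - (Num.truncn y)%:R : R| <= `|x - y| + 1.
Proof.
have H a b : (Num.truncn a)%:R - (Num.truncn b)%:R <= `|a - b| + 1 :> R.
  have [a0|a0] := leP 0 a; last first.
    have -> : Num.truncn a = 0%N by rewrite truncn_floor leNgt a0.
    by apply: (@le_trans _ _ 0); rewrite ?addr_ge0 // sub0r oppr_le0.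
  have ta : (Num.truncn a)%:R <= a by rewrite truncn_le.
  have tb : b < (Num.truncn b).+1%:R.
    have [b0|b0] := leP 0 b; first by case/andP: (truncn_itv b0).
    by apply: lt_le_trans b0 _.
  have := ler_norm (a - b); rewrite -natr1 in tb; lra.
rewrite ler_norml lerNl opprB H andbT.
by rewrite distrC H.
Qed.

Let m n := (Num.truncn (d n)).+1.

Lemma scale_lt n : d n < (m n)%:R.
Proof. by have /andP[] := truncn_itv (ltW (d_gt0 n)). Qed.

Lemma scale_le n : (m n)%:R <= d n + 1.
Proof. by have /andP[+ _] := truncn_itv (ltW (d_gt0 n)); rewrite -natr1 lerD2r. Qed.

Let loop_point n (t : R) : X :=
  mq_proj DC (CVertex (take (Num.truncn ((6 * m n)%:R * t)) (loop (m n)))).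

Lemma loop_point_lipschitz : exists2 C : R, 0 <= C & forall n s t,
  mdist (loop_point n s) (loop_point n t) <= C * ((6 * m n)%:R * `|s - t| + 1).
Proof.
have [C C0 HC] := cayley_chain_word R genS; exists C => // n s t.
have take_dist w i j : (i <= j)%N ->
    cayley_dist G_relators S (CVertex (take i w)) (CVertex (take j w)) <=
      C * `|i%:R - j%:R| :> R.
  move=> ij; have [l lw lC] := HC (take i w) (drop i (take j w)).
  have wE : take i w ++ drop i (take j w) = take j w.
    by rewrite -(take_takel w ij) cat_take_drop.
  rewrite wE in lw.
  apply: le_trans (cayley_dist_le lw) (le_trans lC _).
  rewrite ler_wpM2l // distrC -natrB // ger0_norm // ler_nat size_drop leq_sub2r //.
  by rewrite size_take_min geq_minl.
rewrite mdist_cayley; apply: (@le_trans _ _ (C * `|(Num.truncn ((6 * m n)%:R * s))%:R -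
    (Num.truncn ((6 * m n)%:R * t))%:R|)).
  have [ij|/ltnW ij] := leqP (Num.truncn ((6 * m n)%:R * s)) (Num.truncn ((6 * m n)%:R * t)).
    exact: take_dist.
  by rewrite cayley_distC distrC; apply: take_dist.
rewrite ler_wpM2l //; apply: le_trans (truncn_dist _ _) _.
by rewrite lerD2r -mulrBr normrM ger0_norm.
Qed.

Lemma loop_point_bounded t : exists M, forall n, mdist (o n) (loop_point n t) / d n <= M.
Proof.
have [C C0 HC] := loop_point_lipschitz.
have o0 n : o n = loop_point n 0 by rewrite /loop_point mulr0 truncn0 take0.
exists (C * (6 * (1 + 1 / d 0) * `|t| + 1 / d 0)) => n.
rewrite o0 ler_pdivrMr //; apply: le_trans (HC n 0 t) _.
rewrite -[leRHS]mulrA ler_wpM2l // sub0r normrN mulrDl; apply: lerD.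
  rewrite mulrAC ler_wpM2r // natrM -mulrA ler_wpM2l // mulrDl !mul1r.
  apply: le_trans (scale_le n) _; rewrite lerD2l mulrC ler_pdivlMr // mul1r.
  exact: d_ge0.
by rewrite mul1r mulrC ler_pdivlMr // mul1r.
Qed.

Definition loop_path (t : R) : cone_seq o d :=
  exist _ (loop_point^~ t) (let: ex_intro _ MP := loop_point_bounded t in
    cone_seq_of_bounded MP).

Hypothesis d_unbounded : forall B : R, \forall n \near omega, B <= d n.

Lemma loop_path_is_path :
  is_path (fun t => mq_proj (cone_pseudodist ultra o d_gt0) (loop_path t) :
    asymptotic_cone ultra o d_gt0).
Proof.
have [C C0 HC] := loop_point_lipschitz.
apply: (@lipschitz_is_path _ _ _ _ _ _ _ _ (6 * C)) => s t.
apply: (cone_dist_le ultra d_gt0) => e e0.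
have := d_unbounded (C * (6 * `|s - t| + 1) / e); apply: filterS => n dn.
rewrite ler_pdivrMr // in dn *.
rewrite ler_pdivrMr //; apply: le_trans (HC n s t) _.
rewrite mulrDl; apply: (@le_trans _ _ (C * (6 * d n * `|s - t| + (6 * `|s - t| + 1)))).
  rewrite ler_wpM2l // addrA lerD2r -mulrDl ler_wpM2r // natrM -[X in _ + X]mulr1 -mulrDr.
  by rewrite ler_wpM2l // scale_le.
rewrite mulrDr [e * _]mulrC; apply: lerD => //.
by rewrite le_eqVlt; apply/orP; left; apply/eqP; ring.
Qed.

(** The loops of size proportional to [d n] form a path in the cone; a null-homotopy
    of it fills them, for almost all [n], with a grid whose number of cells does not
    depend on [n]. *)
Lemma unbounded_not_simply_connected :
  ~ simply_connected R (asymptotic_cone ultra o d_gt0).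
Proof.
move=> sc.
have loop01 : cone_dist omega (loop_path 0) (loop_path 1) = 0.
  apply/eqP; rewrite eq_le (pdist_ge0 (cone_pseudodist ultra o d_gt0)) andbT.
  apply: (cone_dist_le ultra d_gt0) => e e0; apply: filterE => n.
  rewrite add0r /= mdist_cayley mulr0 truncn0 take0 mulr1 natrK.
  rewrite take_oversize ?size_loop //.
  have /cayley_dist_le : cayley_chain G_relators S (CVertex [::])
      (CVertex (loop (m n)) : cayley_point R gen I) 0.
    by apply: cchain_vertex; apply: weq_sym; apply: loop_trivial.
  by move=> H; rewrite ler_pdivrMr //; apply: le_trans H _; rewrite mulr_ge0 // ltW.
(* Neighbours on the grid will be at word distance at most d n / 32 + 2 * L. *)
pose L : R := (edge_bound S).+1%:R.
have L0 : 0 < L by rewrite ltr0n.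
pose e := (32 * L)^-1; have e0 : 0 < e by rewrite invr_gt0 mulr_gt0.
have [N0 HN] := cone_grid sc loop_path_is_path loop01 e0.
pose K := maxn N0 32; pose N := (6 * K)%N.
have K0 : (0 < K)%N by rewrite leq_max orbT.
have K32 : (32 <= K)%N by rewrite leq_max leqnn orbT.
have NN0 : (N0 <= N)%N by rewrite /N /K; lia.
have Npos : (0 < N)%N by rewrite /N; lia.
have nearH := d_unbounded (32 * L + 100 + (2 * N.+1 ^ 2 + 1)%:R + K%:R).
have [n [[f [f0 fN fs fh fv]] dn]] := filter_ex (filterI (HN N NN0 Npos) nearH).
pose r := (Num.truncn (L * (e * d n + 2)) + m n %/ K + 1)%N.
have LE : L * (e * d n + 2) = d n / 32 + 2 * L.
  by rewrite /e; field; rewrite gt_eqF.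
have mn1 := scale_lt n; have mn2 := scale_le n; have dn0 := d_gt0 n.
have {dn} [dL dN dK] : [/\ 32 * L + 100 <= d n, (2 * N.+1 ^ 2 + 1)%:R <= d n & K%:R <= d n].
  have H x y : 0 <= x -> 0 <= y -> 32 * L + 100 + x + y <= d n ->
      [/\ 32 * L + 100 <= d n, x <= d n & y <= d n] by move=> *; split; lra.
  exact: H.
have mK : (m n %/ K)%:R <= (d n + 1) / 32.
  apply: (@le_trans _ _ ((m n)%:R / 32)); last by rewrite ler_pM2r ?invr_gt0.
  rewrite ler_pdivlMr // -natrM ler_nat.
  by apply: leq_trans (leq_divM (m n) K); rewrite leq_mul2l K32 orbT.
have rn : (8 * r < m n)%N.
  rewrite -(ltr_nat R); apply: lt_trans mn1; rewrite /r natrM !natrD.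
  have : (Num.truncn (L * (e * d n + 2)))%:R <= d n / 32 + 2 * L.
    by rewrite -LE truncn_le LE addr_ge0 ?mulr_ge0 // ltW.
  lra.
have Km : (K <= m n)%N by rewrite -(ler_nat R); apply: le_trans dK (ltW mn1).
have Nm : (2 * N.+1 ^ 2 + 1 < m n)%N.
  by rewrite -(ltr_nat R); apply: le_lt_trans dN mn1.
have nKr : (m n %/ K < r)%N by rewrite /r addn1 ltnS leq_addl.
pose rep i j : cayley_point R gen I :=
  if i == 0%N then CVertex (take ((m n * j) %/ K) (loop (m n)))
  else if [|| i == N, j == 0%N | j == N] then CVertex [::] else repr (f i j).
have val0 : val (loop_path 0) n = mq_proj DC (CVertex [::]).
  by rewrite /= /loop_point mulr0 truncn0 take0.
have repE i j : (i <= N)%N -> (j <= N)%N -> mq_proj DC (rep i j) = f i j.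
  move=> iN jN; rewrite /rep; case: eqP => [->|/eqP i0].
    rewrite f0 //= /loop_point; congr (mq_proj DC (CVertex (take _ _))).
    apply/esym/truncn_def; rewrite /N.
    have -> : (6 * m n)%:R * (j%:R / (6 * K)%:R) = (m n * j)%:R / K%:R :> R.
      rewrite !natrM; field; by rewrite pnatr_eq0 -lt0n.
    rewrite ler_pdivlMr ?ltr0n // ltr_pdivrMr ?ltr0n // -!natrM ler_nat ltr_nat.
    by rewrite leq_divM ltn_ceil.
  rewrite -lt0n in i0.
  case: eqP => [->|_] /=; first by rewrite fN // val0.
  case: eqP => [->|_] /=; first by case: (fs i i0 iN) => -> _; rewrite val0.
  case: eqP => [->|_] /=; first by case: (fs i i0 iN) => _ ->; rewrite val0.
  exact: reprK.
have near_rep i j i' j' : (i <= N)%N -> (j <= N)%N -> (i' <= N)%N -> (j' <= N)%N ->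
    mdist (f i j) (f i' j') < e * d n ->
    word_within r (cayley_base (rep i j)) (cayley_base (rep i' j')).
  move=> iN jN i'N j'N; rewrite -!repE // mdist_cayley.
  move=> /(cayley_dist_chain genS)[l le lc].
  apply: word_withinW (word_within_norm _ _).
  apply: (@leq_trans (Num.truncn (L * (e * d n + 2))));
    last by rewrite /r -addnA leq_addr.
  rewrite truncn_ge_nat; last by rewrite LE addr_ge0 ?mulr_ge0 // ltW.
  apply: le_trans (word_norm_chain lc) _.
  have l0 := cayley_chain_ge0 lc.
  apply: ler_pM => //; [by rewrite addr_ge0|by rewrite ler_nat|by rewrite lerD2r ltW].
apply: (@coarse_filling_false (m n) r K (fun i j => cayley_base (rep i j))) => //.
- move=> i j iN jN; apply: near_rep => //; first exact: ltnW.
  exact: fh.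
- move=> i j iN jN; apply: near_rep => //; first exact: ltnW.
  exact: fv.
- by move=> j jN; rewrite /rep eqxx (gtn_eqF Npos).
- by move=> i i0 iN; rewrite /rep !eqxx (gtn_eqF i0) !orbT.
Qed.

End UnboundedScales.

(** * Cones with bounded scales: winding numbers around an edge *)

Section CircleDifference.
Variable R : realType.
Implicit Types x y z : R.

(** The representative of [y - x] modulo 1 between -1/2 and 1/2, for [x] and [y] in
    the unit interval. *)
Definition circle_diff x y : R :=
  if `|y - x| < 2^-1 then y - x else if x <= y then y - x - 1 else y - x + 1.

Lemma circle_diffxx x : circle_diff x x = 0.
Proof. by rewrite /circle_diff subrr normr0 invr_gt0 ltr0n. Qed.

Lemma circle_diff_ends x y : (x = 0 \/ x = 1) -> (y = 0 \/ y = 1) -> circle_diff x y = 0.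
Proof.
have h : (1 < 2^-1 :> R) = false by apply/negbTE; rewrite -leNgt; lra.
move=> [] -> [] ->; rewrite ?circle_diffxx // /circle_diff.
  by rewrite subr0 normr1 h ler01 subrr.
by rewrite sub0r normrN normr1 h ler10 addNr.
Qed.

Lemma circle_diff_small x y (z : int) : 0 <= x <= 1 -> 0 <= y <= 1 ->
    `|x - y + z%:~R| < 1 / 4 ->
  `|circle_diff x y| < 1 / 4 /\ exists w : int, circle_diff x y = y - x + w%:~R.
Proof.
move=> /andP[x0 x1] /andP[y0 y1]; rewrite ltr_norml => /andP[h1 h2].
have z1 : (z < 2)%R by rewrite -(ltr_int R); lra.
have z2 : (- 2%:Z < z)%R by rewrite -(ltr_int R) intrN; lra.
have : z = -1 \/ z = 0 \/ z = 1 by lia.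
rewrite /circle_diff ltr_norml => zE; split.
  rewrite ltr_norml; case: ifPn => [/andP[h3 h4]|].
    by case: zE h1 h2 => [->|[->|->]]; rewrite ?intrN => h1 h2; apply/andP; split; lra.
  rewrite negb_and -!leNgt => /orP h3.
  by case: ifPn => xy; rewrite -?ltNge in xy;
    case: zE h1 h2 => [->|[->|->]]; rewrite ?intrN => h1 h2; apply/andP; split;
    case: h3; lra.
case: ifP => _; first by exists 0; rewrite addr0.
by case: ifP => _; [exists (-1); rewrite intrN|exists 1].
Qed.

Lemma small_int_eq0 (x : R) (z : int) : `|x| < 1 -> x = z%:~R -> x = 0.
Proof.
move=> + xz; rewrite xz -intr_norm -[1]/(1%:~R) ltr_int => z1.
by have -> : z = 0 by lia.
Qed.

(** A map from a fine grid to the circle has a lift, so its increments form a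
    cocycle. *)
Lemma circle_grid (a : nat -> nat -> R) N :
    (forall i j, (i <= N)%N -> (j <= N)%N -> 0 <= a i j <= 1) ->
    (forall i j, (i <= N)%N -> (j < N)%N ->
      exists z : int, `|a i j - a i j.+1 + z%:~R| < 1 / 4) ->
    (forall i j, (i < N)%N -> (j <= N)%N ->
      exists z : int, `|a i j - a i.+1 j + z%:~R| < 1 / 4) ->
    (forall i, (i < N)%N -> circle_diff (a i 0%N) (a i.+1 0%N) = 0) ->
    (forall i, (i < N)%N -> circle_diff (a i N) (a i.+1 N) = 0) ->
    (forall j, (j < N)%N -> circle_diff (a N j) (a N j.+1) = 0) ->
  \sum_(j < N) circle_diff (a 0%N j) (a 0%N j.+1) = 0.
Proof.
move=> a01 ah av v0 vN hN.
have H := @grid_sum R (fun i j => circle_diff (a i j) (a i j.+1))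
  (fun i j => circle_diff (a i j) (a i.+1 j)) N.
have /H : forall i j, (i < N)%N -> (j < N)%N ->
    circle_diff (a i j) (a i j.+1) + circle_diff (a i j.+1) (a i.+1 j.+1) =
    circle_diff (a i j) (a i.+1 j) + circle_diff (a i.+1 j) (a i.+1 j.+1).
  move=> i j iN jN.
  have h x y : (exists z : int, `|x - y + z%:~R| < 1 / 4) -> 0 <= x <= 1 -> 0 <= y <= 1 ->
    `|circle_diff x y| < 1 / 4 /\ exists w : int, circle_diff x y = y - x + w%:~R.
    by move=> [z zP] x01 y01; apply: circle_diff_small zP.
  have [s1 [w1 E1]] := h _ _ (ah i j (ltnW iN) jN)
    (a01 _ _ (ltnW iN) (ltnW jN)) (a01 _ _ (ltnW iN) jN).
  have [s2 [w2 E2]] := h _ _ (av i j.+1 iN jN)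
    (a01 _ _ (ltnW iN) jN) (a01 _ _ iN jN).
  have [s3 [w3 E3]] := h _ _ (av i j iN (ltnW jN))
    (a01 _ _ (ltnW iN) (ltnW jN)) (a01 _ _ iN (ltnW jN)).
  have [s4 [w4 E4]] := h _ _ (ah i.+1 j iN jN)
    (a01 _ _ iN (ltnW jN)) (a01 _ _ iN jN).
  apply/eqP; rewrite -subr_eq0; apply/eqP.
  apply: (@small_int_eq0 _ (w1 + w2 - w3 - w4)).
    move: s1 s2 s3 s4; rewrite !ltr_norml.
    by move=> /andP[? ?] /andP[? ?] /andP[? ?] /andP[? ?]; apply/andP; split; lra.
  by rewrite E1 E2 E3 E4 !intrD !intrN; ring.
rewrite [X in _ + X = _]big1 ?addr0; last by move=> i _; apply: vN.
rewrite [X in _ = X + _]big1 ?add0r; last by move=> i _; apply: v0.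
by rewrite [RHS]big1 // => j _; apply: hN.
Qed.

End CircleDifference.

Section EdgeWinding.
Variables (R : realType) (I : finType) (S : I -> word gen).
Notation point := (cayley_point R gen I).
Notation chain := (cayley_chain G_relators S).
Implicit Types (p q : point) (g h : word gen) (u : word I) (l : I * bool) (x y : R).

Definition on_edge (e : word gen * I) g (j : I) : bool :=
  (j == e.2) && `[< group_eq G_relators g e.1 >].

(** The position on the edge [e], after the complement of the open edge has been
    collapsed to the point 0 = 1 of the circle. *)
Definition edge_coord e p : R :=
  if p is CEdge g j t then if on_edge e g j then val t else 0 else 0.

Lemma on_edge_eq e g h j : group_eq G_relators g h -> on_edge e g j = on_edge e h j.
Proof.
move=> gh; rewrite /on_edge; congr (_ && _); apply/asboolP/asboolP => H.
  by rewrite -gh.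
by rewrite gh.
Qed.

Lemma edge_coord_ge0le1 e p : 0 <= edge_coord e p <= 1.
Proof. by case: p => [g|g j [t t01]] /=; [|case: ifP]; rewrite ?lexx ?ler01. Qed.

(** Collapsing the complement of an edge does not increase distances. *)
Lemma edge_coord_chain e p q (r : R) : chain p q r ->
  exists z : int, `|edge_coord e p - edge_coord e q + z%:~R| <= r.
Proof.
elim=> /= [g h gh|g h i s t gh|g i s s0|g i s s1
  |p1 q1 l1 _ [z H]|p1 q1 r1 l1 m1 _ [z H] _ [w H']].
- by exists 0; rewrite subrr addr0 normr0.
- exists 0; rewrite (on_edge_eq e i gh) addr0; case: ifP => // _.
  by rewrite subrr normr0.
- by exists 0; rewrite s0 if_same subrr addr0 normr0.
- exists (if on_edge e g i then -1 else 0); rewrite s1; case: ifP => _.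
    by rewrite subr0 intrN subrr normr0.
  by rewrite subrr addr0 normr0.
- exists (- z); rewrite -normrN intrN opprD opprB opprK addrC.
  by rewrite addrC.
- exists (z + w); rewrite intrD.
  apply: le_trans (lerD H H'); apply: le_trans (ler_normD _ _).
  rewrite le_eqVlt; apply/orP; left; apply/eqP; congr `|_|; ring.
Qed.

Lemma clamp_subproof x : 0 <= Num.min 1 (Num.max 0 x) <= 1.
Proof. by rewrite le_min ler01 le_max lexx ge_min lexx. Qed.

Definition clamp x : {t : R | 0 <= t <= 1} :=
  exist (fun t => is_true (0 <= t <= 1)) _ (clamp_subproof x).

Lemma clampE x : 0 <= x <= 1 -> val (clamp x) = x.
Proof. by move=> /andP[x0 x1] /=; rewrite max_r // min_r. Qed.

Lemma clamp_dist x y : `|val (clamp x) - val (clamp y)| <= `|x - y|.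
Proof.
have cE z : val (clamp z) = if z <= 0 then 0 else if z <= 1 then z else 1.
  rewrite /=; case: ifPn => [z0|]; first by rewrite max_l // min_r // ler01.
  rewrite -ltNge => /ltW z0; rewrite max_r //; case: ifPn => [z1|].
    by rewrite min_r.
  by rewrite -ltNge => /ltW z1; rewrite min_l.
have n1 := ler_norm (x - y); have n2 := ler_norm (y - x); rewrite distrC in n2.
rewrite !cE ler_norml; case: (leP x 0) => x0; case: (leP y 0) => y0;
  try case: (leP x 1) => x1; try case: (leP y 1) => y1; apply/andP; split; lra.
Qed.

Definition letter_word l : word gen := if l.2 then winv (S l.1) else S l.1.

(** The letter [(j, true)] runs backwards through the edge starting at [g (S j)^-1]. *)
Definition edge_point g l x : point :=
  if l.2 then CEdge (g ++ winv (S l.1)) l.1 (clamp (1 - x))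
  else CEdge g l.1 (clamp x).

Fixpoint path_point g u x : point :=
  if u is l :: u' then
    if x < 1 then edge_point g l x else path_point (g ++ letter_word l) u' (x - 1)
  else CVertex g.

Lemma edge_point_chain g l x y :
  exists2 r, chain (edge_point g l x) (edge_point g l y) r & r <= `|x - y|.
Proof.
case: l => j [] /=; rewrite /edge_point /=.
  exists `|val (clamp (1 - x)) - val (clamp (1 - y))|.
    by apply: cchain_edge; apply: weq_refl.
  apply: le_trans (clamp_dist _ _) _.
  by have -> : 1 - x - (1 - y) = y - x by [ring]; rewrite distrC.
exists `|val (clamp x) - val (clamp y)|; last exact: clamp_dist.
by apply: cchain_edge; apply: weq_refl.
Qed.

Lemma edge_point_start g l : chain (edge_point g l 0) (CVertex g) 0.
Proof.
case: l => j [] /=; rewrite /edge_point /=.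
  have c1 : val (clamp (1 - 0)) = 1 by rewrite clampE subr0 // ler01 lexx.
  have gE : group_eq G_relators ((g ++ winv (S j)) ++ S j) g.
    by rewrite -catA weq_winvl cats0; apply: weq_refl.
  have := cchain_trans
    (@cchain_target R gen G_relators I S (g ++ winv (S j)) j _ c1)
    (@cchain_vertex R gen G_relators I S _ _ gE).
  by rewrite addr0.
by apply: cchain_source; rewrite clampE // ler01 lexx.
Qed.

Lemma edge_point_end g l : chain (edge_point g l 1) (CVertex (g ++ letter_word l)) 0.
Proof.
case: l => j [] /=; rewrite /edge_point /letter_word /=.
  by apply: cchain_source; rewrite clampE subrr // ler01 lexx.
by apply: cchain_target; rewrite clampE // ler01 lexx.
Qed.

Lemma path_point_start g u : chain (path_point g u 0) (CVertex g) 0.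
Proof.
case: u => [|l u] /=; first exact: cayley_chainxx.
by rewrite ltr01; apply: edge_point_start.
Qed.

Lemma path_point_chain g u x y : x <= y ->
  exists2 r, chain (path_point g u x) (path_point g u y) r & r <= y - x.
Proof.
elim: u g x y => [|l u IH] g x y xy /=.
  by exists 0; [exact: cayley_chainxx|rewrite subr_ge0].
have [x1|x1] := ltP x 1; have [y1|y1] := ltP y 1.
- have [r rc rxy] := edge_point_chain g l x y; exists r => //.
  by rewrite distrC ger0_norm ?subr_ge0 // in rxy.
- have [r1 c1 r1x] := edge_point_chain g l x 1.
  have [r2 c2 r2y] := IH (g ++ letter_word l) 0 (y - 1) (ltac:(lra)).
  have c12 := cchain_trans c1 (cchain_trans (edge_point_end g l)
    (cchain_trans (cchain_sym (path_point_start (g ++ letter_word l) u)) c2)).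
  exists (r1 + (0 + (0 + r2))) => //.
  rewrite distrC ger0_norm in r1x; lra.
- by have := lt_le_trans y1 x1; rewrite ltNge xy.
- have [r c rxy] := IH (g ++ letter_word l) (x - 1) (y - 1) (ltac:(lra)).
  by exists r => //; lra.
Qed.

Lemma path_point_end g u :
  path_point g u (size u)%:R = CVertex (g ++ wsubst S u).
Proof.
elim: u g => [|l u IH] g /=; first by rewrite cats0.
have -> : ((size u).+1%:R < 1 :> R) = false by rewrite -natr1 ltNge lerDr ler0n.
rewrite -natr1 addrK IH /wsubst /= -catA.
by case: l.
Qed.

Definition crossing (e : word gen * I) g l : int :=
  if on_edge e (if l.2 then g ++ winv (S l.1) else g) l.1 then sgz_of l.2 else 0.

Fixpoint crossing_number e g u : int :=
  if u is l :: u' then crossing e g l + crossing_number e (g ++ letter_word l) u'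
  else 0.

Lemma edge_coord_start e g u : edge_coord e (path_point g u 0) = 0 \/
  edge_coord e (path_point g u 0) = 1.
Proof.
case: u => [|[j b] u] /=; first by left.
rewrite ltr01 /edge_point /=; case: b; rewrite /edge_coord; case: ifP => _; try by left.
  by right; rewrite clampE ?subr0 ?lexx ?ler01.
by left; rewrite clampE ?lexx ?ler01.
Qed.

Lemma winding_letter e g l (K : nat) z : (3 <= K)%N -> (z = 0 \/ z = 1) ->
  \sum_(j < K) circle_diff (edge_coord e (edge_point g l (j%:R / K%:R)))
     (if j.+1 == K then z else edge_coord e (edge_point g l (j.+1%:R / K%:R)))
  = (crossing e g l)%:~R.
Proof.
move=> K3 z01.
have K0 : 0 < K%:R :> R by rewrite ltr0n; lia.
have K3' : 3 <= K%:R :> R by rewrite ler_nat.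
have K1 : K%:R^-1 < 2^-1 :> R by rewrite invf_plt ?posrE //; lra.
have Kp : 0 < K%:R^-1 :> R by rewrite invr_gt0.
have unit j : (j <= K)%N -> 0 <= (j%:R / K%:R : R) <= 1.
  by move=> jK; rewrite divr_ge0 ?ler0n // ler_pdivrMr // mul1r ler_nat.
have nxt j : j.+1%:R / K%:R = j%:R / K%:R + K%:R^-1 :> R.
  by rewrite -natr1 mulrDl mul1r.
have lastE j : j.+1 = K -> j%:R / K%:R = 1 - K%:R^-1 :> R.
  move=> jK; apply/(addIr K%:R^-1); rewrite -nxt jK subrK divff //.
  by rewrite gt_eqF.
rewrite /crossing; case: l => i b /=; rewrite /edge_point /=.
set edge := on_edge _ _ _.
have coordE t : edge_coord e (if b then CEdge (g ++ winv (S i)) i (clamp (1 - t))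
    else CEdge g i (clamp t)) =
    if edge then val (clamp (if b then 1 - t else t)) else 0.
  by rewrite /edge; case: (b).
under eq_bigr do rewrite !coordE.
case: edge {coordE}; last first.
  by rewrite big1 // => j _; apply: circle_diff_ends; [left|case: ifP => _; [|left]].
have term j : (j < K)%N ->
    circle_diff (val (clamp (if b then 1 - j%:R / K%:R else j%:R / K%:R)))
      (if j.+1 == K then z
       else val (clamp (if b then 1 - j.+1%:R / K%:R else j.+1%:R / K%:R))) =
    (sgz_of b)%:~R / K%:R :> R.
  move=> jK; have uj := unit j (ltnW jK); have uj' := unit j.+1 jK.
  have ce t : 0 <= t <= 1 -> val (clamp (if b then 1 - t else t)) = if b then 1 - t else t.
    move=> /andP[t0 t1]; case: b; apply: clampE; rewrite ?t0 ?t1 //.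
    by rewrite subr_ge0 t1 lerBlDr lerDl.
  rewrite !ce //; case: eqP => [jE|_].
    rewrite lastE // /circle_diff; case: (b) => /=; rewrite ?intrN ?mulN1r ?mul1r.
      have -> : 1 - (1 - K%:R^-1) = K%:R^-1 :> R by ring.
      case: z01 => ->.
        by rewrite sub0r normrN gtr0_norm // K1.
      have -> : (`|1 - K%:R^-1| < 2^-1 :> R) = false.
        by apply/negbTE; rewrite -leNgt ger0_norm; lra.
      have -> : (K%:R^-1 <= 1 :> R) by lra.
      by ring.
    case: z01 => ->; last first.
      have -> : 1 - (1 - K%:R^-1) = K%:R^-1 :> R by ring.
      by rewrite gtr0_norm // K1.
    have -> : (`|0 - (1 - K%:R^-1)| < 2^-1 :> R) = false.
      by apply/negbTE; rewrite -leNgt sub0r normrN ger0_norm; lra.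
    have -> : (1 - K%:R^-1 <= 0 :> R) = false by apply/negbTE; rewrite -ltNge; lra.
    by ring.
  rewrite nxt /circle_diff; case: (b) => /=; rewrite ?intrN ?mulN1r ?mul1r.
    have -> : 1 - (j%:R / K%:R + K%:R^-1) - (1 - j%:R / K%:R) = - K%:R^-1 :> R by ring.
    by rewrite normrN gtr0_norm // K1.
  by rewrite addrC addKr gtr0_norm // K1.
under eq_bigr => j _ do rewrite term //.
by rewrite sumr_const card_ord -[LHS]mulr_natr mulfVK // gt_eqF.
Qed.

(** Only the letters that run through the edge [e] move around the circle, each of
    them once. *)
Lemma winding_path e g u (K : nat) : (3 <= K)%N ->
  \sum_(j < K * size u) circle_diff (edge_coord e (path_point g u (j%:R / K%:R)))
     (edge_coord e (path_point g u (j.+1%:R / K%:R)))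
  = (crossing_number e g u)%:~R.
Proof.
move=> K3; have K0 : 0 < K%:R :> R by rewrite ltr0n; lia.
elim: u g => [|l u IH] g; first by rewrite muln0 big_ord0.
rewrite [size _]/= mulnS big_split_ord /= intrD -IH.
congr (_ + _).
  rewrite -(@winding_letter e g l K _ K3 (edge_coord_start e (g ++ letter_word l) u)).
  apply: eq_bigr => j _.
  have lt1 i : (i < K)%N -> i%:R / K%:R < 1 :> R.
    by move=> iK; rewrite ltr_pdivrMr // mul1r ltr_nat.
  rewrite lt1 //; congr (circle_diff _ _).
  case: eqP => [jK|/eqP jK].
    by rewrite jK divff ?gt_eqF // ltxx subrr.
  by rewrite lt1 // ltn_neqAle jK /=.
apply: eq_bigr => j _.
have shift i : ((K + i)%:R / K%:R < 1 :> R) = false /\ (K + i)%:R / K%:R - 1 = i%:R / K%:R :> R.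
  rewrite natrD mulrDl divff ?gt_eqF //; split; last by rewrite addrC addKr.
  by apply/negbTE; rewrite -leNgt lerDl divr_ge0 // ler0n.
have [-> ->] := shift j; rewrite -addnS; have [-> ->] := shift j.+1.
by [].
Qed.

End EdgeWinding.

(** * A group all of whose closed paths have winding number zero *)

Section FreeBasis.
Variables (I : finType) (S : I -> word gen).
Implicit Types (g h : word gen) (u : word I).

Lemma wsubst_cons l u : wsubst S (l :: u) = letter_word S l ++ wsubst S u.
Proof. by []. Qed.

Lemma wsubst_cat u v : wsubst S (u ++ v) = wsubst S u ++ wsubst S v.
Proof. by rewrite /wsubst map_cat flatten_cat. Qed.

Lemma crossing_letter i b g u h : 0 < sgz_of b * crossing_number S (h, i) g u ->
  exists x y, u = x ++ (i, b) :: y /\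
    group_eq G_relators
      (if b then (g ++ wsubst S x) ++ winv (S i) else g ++ wsubst S x) h.
Proof.
elim: u g => [|l u IH] g /=; first by rewrite mulr0.
case: (boolP ((l.2 == b) && (crossing S (h, i) g l != 0))) => [/andP[/eqP lb]|lN H].
  rewrite /crossing; case: ifP => // /andP[/eqP /= li /asboolP /= gh] _ _.
  exists [::], u; rewrite cats0 -lb -li; split; first by case: (l).
  by case: (l) lb gh => j [] /=.
have [|x [y [uE hx]]] := IH (g ++ letter_word S l).
  move: lN H; rewrite /crossing; case: l => j c /=; case: ifP => _; last by rewrite add0r.
  by case: (b) (c) => [] [] //=; rewrite ?mulN1r ?mul1r; lia.
exists (l :: x), y; rewrite uE; split=> //.
by rewrite wsubst_cons !catA; move: hx; case: (b).
Qed.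

(** The edge crossed by the first letter of a closed path has to be crossed
    again in the opposite direction; this splits the path into two shorter
    closed paths. *)
Lemma closed_word_trivial :
    (forall e u, group_eq G_relators (wsubst S u) [::] -> crossing_number S e [::] u = 0) ->
  forall u, group_eq G_relators (wsubst S u) [::] -> freely_equal u [::].
Proof.
move=> H u; have [n] := ubnP (size u); elim: n u => // n IH [|[i b] u] un uE.
  exact: weq_refl.
pose h := if b then winv (S i) else [::].
have hE : letter_word S (i, b) = (if b then winv (S i) else S i) by [].
have c0 : crossing S (h, i) [::] (i, b) = sgz_of b.
  by rewrite /crossing /on_edge /= eqxx /h; case: (b) => /=;
    rewrite (_ : `[< _ >]) //; apply/asboolP; apply: weq_refl.
have := H (h, i) _ uE; rewrite /= c0 => cu.
have [|x [y [uxy xh]]] := @crossing_letter i (~~ b) (letter_word S (i, b)) u h.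
  by case: (b) cu => /=; lia.
have x1 : group_eq G_relators (wsubst S x) [::].
  apply: (@weq_catK _ _ (letter_word S (i, b))); rewrite cats0.
  move: xh; rewrite hE /h; case: (b) => /= xh; first exact: xh.
  apply: (@weq_catKr _ _ (winv (S i))); rewrite xh weq_winvr; exact: weq_refl.
have y1 : group_eq G_relators (wsubst S y) [::].
  move: uE; rewrite uxy wsubst_cons wsubst_cat wsubst_cons x1 => uE.
  apply: weq_trans uE; rewrite cat0s catA /letter_word /=; case: (b) => /=.
    by rewrite weq_winvl; apply: weq_refl.
  by rewrite weq_winvr; apply: weq_refl.
have sx : (size x < n)%N.
  by move: un; rewrite uxy /= size_cat /=; lia.
have sy : (size y < n)%N.
  by move: un; rewrite uxy /= size_cat /=; lia.
have -> : (i, b) :: u = [:: (i, b)] ++ x ++ [:: (i, ~~ b)] ++ y by rewrite uxy.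
rewrite (IH x sx x1) (IH y sy y1).
exact: (weq_cancel _ [::] [::] (i, b)).
Qed.

End FreeBasis.

(** * The group is not free *)

(** The integral Heisenberg group: (x, y, z) is the upper unitriangular matrix
    with x and y above the diagonal and z in the corner. *)
Definition heis := (int * int * int)%type.

Definition heis_mul (p q : heis) : heis :=
  let: (x, y, z) := p in let: (x', y', z') := q in (x + x', y + y', z + z' + x * y').

Lemma heis_mulA : associative heis_mul.
Proof.
by move=> [[x y] z] [[x' y'] z'] [[x2 y2] z2] /=; congr (_, _, _); ring.
Qed.

Definition heis_eval (X : Type) (f : X -> int * int) (w : word X) : heis :=
  foldr (fun l p => heis_mul (let: (x, y) := f l.1 in
    if l.2 then (- x, - y, x * y) else (x, y, 0)) p) (0, 0, 0) w.

Lemma heis_eval_cat X (f : X -> int * int) u v :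
  heis_eval f (u ++ v) = heis_mul (heis_eval f u) (heis_eval f v).
Proof.
elim: u => [|l u IH] /=; last by rewrite IH heis_mulA.
by case: (heis_eval f v) => [[x y] z]; rewrite /= !add0r mul0r addr0.
Qed.

Lemma heis_eval_free X (f : X -> int * int) u v :
  freely_equal u v -> heis_eval f u = heis_eval f v.
Proof.
elim=> [//|//|u1 v1 w1 _ -> _ -> //|u1 v1 [x b]|//].
rewrite !heis_eval_cat heis_mulA; congr heis_mul.
case: (heis_eval f u1) => [[x1 y1] z1] /=; case: (f x) => y z.
by case: b => /=; congr (_, _, _); ring.
Qed.

Definition abel_letter (x : gen) : int * int :=
  match x with theta1 => (1, 0) | gen_k => (0, 1) | _ => (0, 0) end.

Definition abel (w : word gen) : int * int := (heis_eval abel_letter w).1.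

Lemma abel_cat u v : abel (u ++ v) = ((abel u).1 + (abel v).1, (abel u).2 + (abel v).2).
Proof.
rewrite /abel heis_eval_cat.
by case: (heis_eval _ u) => [[x y] z]; case: (heis_eval _ v) => [[x' y'] z'].
Qed.

Lemma abel_group_eq u v : group_eq G_relators u v -> abel u = abel v.
Proof.
elim=> [//|//|u1 v1 w1 _ -> _ -> //|u1 v1 [x b]|u1 v1 r /G_relatorsP[t [tE rE]]].
  rewrite !abel_cat /= /abel /=.
  by case: (abel_letter x) => y z; case: b => /=; congr (_, _); ring.
rewrite !abel_cat.
have -> : abel r = (0, 0) by case: tE => E; case: rE => ->; rewrite E.
by rewrite /= !add0r.
Qed.

Lemma abel_winv u : abel (winv u) = (- (abel u).1, - (abel u).2).
Proof.
have := abel_group_eq (weq_winvr (fun r => r \in G_relators) u).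
rewrite abel_cat => -[/eqP + /eqP].
rewrite addr_eq0 addr_eq0 => /eqP -> /eqP ->; rewrite !opprK.
by case: (abel _).
Qed.

(** A homomorphism from a free group to Z^2 lifts to the Heisenberg group.  A lift of
    [abel] would map [theta2] to the centre, so that [a = k^-1 theta2^-1 k theta2]
    would be trivial, whereas [a = k^-1 theta1^-1 k theta1] forces it to be a
    nontrivial commutator. *)
Lemma G_not_free (I : finType) (S : I -> word gen) : generates G_relators S ->
  ~ forall u, group_eq G_relators (wsubst S u) [::] -> freely_equal u [::].
Proof.
move=> genS free.
pose E := heis_eval (fun i => abel (S i)).
have E1 u : (E u).1 = abel (wsubst S u).
  elim: u => [//|[i b] u IH].
  rewrite wsubst_cons abel_cat -IH /E [heis_eval _ _]/= -/E /letter_word /=.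
  case: (E u) => [[x y] z] /=; case: b; rewrite ?abel_winv;
    by case: (abel (S i)).
have Eeq u v : group_eq G_relators (wsubst S u) (wsubst S v) -> E u = E v.
  move=> uv; apply: heis_eval_free; apply: (@weq_catKr _ _ (winv v)).
  rewrite weq_winvr; apply: free; rewrite wsubst_cat uv.
  have winv_subst w : wsubst S (winv w) = winv (wsubst S w).
    elim: w => [//|[i b] w IH]; rewrite wsubst_cons winv_cat -IH winv_cons wsubst_cat.
    congr (_ ++ _); rewrite /wsubst /= cats0 /letter_word /=.
    by case: b => //=; rewrite winvK.
  by rewrite winv_subst weq_winvr; apply: weq_refl.
have [u1 e1] := genS [:: (theta1, false)]; have [u2 e2] := genS [:: (theta2, false)].
have [uk ek] := genS [:: (gen_k, false)]; have [ua ea] := genS [:: (gen_a, false)].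
have rel t ut : (t = theta1 \/ t = theta2) ->
    group_eq G_relators [:: (t, false)] (wsubst S ut) ->
    E (uk ++ ut) = E (ut ++ uk ++ ua).
  move=> tE te; apply: Eeq; rewrite !wsubst_cat -te -ek -ea /=.
  have r : [:: (t, true); (gen_k, false); (t, false); (gen_a, true); (gen_k, true)]
      \in G_relators.
    by case: tE => ->; rewrite /G_relators /= !inE eqxx ?orbT.
  have := @weq_relator _ (fun r => r \in G_relators) [:: (t, false)]
    [:: (gen_k, false); (gen_a, false)] _ r.
  move=> /weq_sym H; apply: weq_sym; apply: weq_trans H _ => /=.
  apply: weq_trans (weq_cancel _ [::] [:: (gen_k, false); (t, false); (gen_a, true);
    (gen_k, true); (gen_k, false); (gen_a, false)] (t, false)) _.
  apply: weq_trans (weq_cancel _ [:: (gen_k, false); (t, false); (gen_a, true)]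
    [:: (gen_a, false)] (gen_k, true)) _.
  exact: (weq_cancel _ [:: (gen_k, false); (t, false)] [::] (gen_a, true)).
have := rel _ _ (or_introl erefl) e1; have := rel _ _ (or_intror erefl) e2.
have := E1 u1; have := E1 u2; have := E1 uk; have := E1 ua.
rewrite -(abel_group_eq e1) -(abel_group_eq e2) -(abel_group_eq ek) -(abel_group_eq ea).
rewrite /E !heis_eval_cat -!/E.
case: (E u1) => [[x1 y1] z1]; case: (E u2) => [[x2 y2] z2].
case: (E uk) => [[x3 y3] z3]; case: (E ua) => [[x4 y4] z4].
rewrite /abel /= => -[-> ->] -[-> ->] -[-> ->] -[-> ->].
move=> /(congr1 snd) /= H2 /(congr1 snd) /= H1.
lia.
Qed.

(** * Closed paths in cones with bounded scales *)

Section BoundedScales.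
Variables (R : realType) (I : finType) (S : I -> word gen).
Hypothesis genS : generates G_relators S.
Variables (omega : set_system nat) (ultra : UltraFilter omega).
Variables (d : nat -> R) (d_gt0 : forall n, 0 < d n).
Hypothesis d_ge0 : forall n, d 0 <= d n.
Let X := cayley_graph R genS.
Let DC := cayley_pseudodist R genS.
Let o : nat -> X := fun=> cayley_identity R genS.
Let omega_proper : ProperFilter omega := @ultra_proper _ _ ultra.
Local Existing Instance omega_proper.

Section ConstantPath.
Variable u : word I.

Definition circuit (t : R) : X := mq_proj DC (path_point S [::] u ((size u)%:R * t)).

Lemma circuit_lipschitz s t : mdist (circuit s) (circuit t) <= (size u)%:R * `|s - t|.
Proof.
have H x y : x <= y ->
    cayley_dist G_relators S (path_point S [::] u x) (path_point S [::] u y) <= `|x - y|.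
  move=> xy; have [r c rxy] := path_point_chain S [::] u xy.
  by apply: le_trans (cayley_dist_le c) _; rewrite distrC ger0_norm ?subr_ge0.
rewrite mdist_cayley -[(size u)%:R in leRHS]ger0_norm // -normrM mulrBr.
have [st|/ltW st] := leP ((size u)%:R * s) ((size u)%:R * t); first exact: H.
by rewrite cayley_distC distrC; apply: H.
Qed.

Lemma circuit_bounded t : exists M, forall n, mdist (o n) (circuit t) / d n <= M.
Proof.
exists (mdist (cayley_identity R genS) (circuit t) / d 0) => n.
by rewrite ler_wpM2l ?mdist_ge0 // lef_pV2 ?posrE.
Qed.

Definition circuit_path (t : R) : cone_seq o d :=
  exist _ (fun=> circuit t) (let: ex_intro _ MP := circuit_bounded t in
    cone_seq_of_bounded MP).

Lemma circuit_path_is_path :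
  is_path (fun t => mq_proj (cone_pseudodist ultra o d_gt0) (circuit_path t) :
    asymptotic_cone ultra o d_gt0).
Proof.
apply: (@lipschitz_is_path _ _ _ _ _ _ _ _ ((size u)%:R / d 0)) => s t.
apply: (cone_dist_le ultra d_gt0) => e e0; apply: filterE => n.
apply: ler_wpDr; first exact: ltW.
rewrite mulrAC /=.
apply: (@le_trans _ _ ((size u)%:R * `|s - t| / d n)).
  by rewrite ler_pM2r ?invr_gt0 // circuit_lipschitz.
by rewrite ler_wpM2l ?mulr_ge0 // lef_pV2 ?posrE.
Qed.

Hypothesis u1 : group_eq G_relators (wsubst S u) [::].

Lemma circuit_end : cayley_dist G_relators S
  (path_point S [::] u 0) (path_point S [::] u (size u)%:R : cayley_point R gen I) = 0.
Proof.
apply/eqP; rewrite eq_le (pdist_ge0 DC) andbT path_point_end cat0s.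
have := cchain_trans (path_point_start R S [::] u)
  (@cchain_vertex R gen G_relators I S _ _ (weq_sym u1)).
by rewrite addr0 => /cayley_dist_le.
Qed.

Hypothesis d_bounded : exists B : R, \forall n \near omega, d n <= B.

(** Along the ultrafilter a fine enough grid has mesh less than a quarter of an edge,
    so it is mapped to the circle around any given edge with small increments. *)
Lemma circuit_crossing_number e :
  simply_connected R (asymptotic_cone ultra o d_gt0) ->
  crossing_number S e [::] u = 0.
Proof.
move=> sc; have [->|u0] := eqVneq u [::]; first by [].
have L0 : (0 < size u)%N by rewrite lt0n size_eq0.
have circuit01 : cone_dist omega (circuit_path 0) (circuit_path 1) = 0.
  apply/eqP; rewrite eq_le (pdist_ge0 (cone_pseudodist ultra o d_gt0)) andbT.
  apply: (cone_dist_le ultra d_gt0) => c c0; apply: filterE => n.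
  by rewrite add0r /= mdist_cayley mulr0 mulr1 circuit_end mul0r ltW.
have [B dB] := d_bounded.
have B1 : 0 < `|B| + 1 by rewrite ltr_wpDl.
pose c := (4 * (`|B| + 1))^-1; have c0 : 0 < c by rewrite invr_gt0 mulr_gt0.
have [N0 HN] := cone_grid sc circuit_path_is_path circuit01 c0.
pose K := maxn N0 3; pose N := (K * size u)%N.
have K3 : (3 <= K)%N by rewrite leq_max leqnn orbT.
have KN : (K <= N)%N by rewrite leq_pmulr.
have NN0 : (N0 <= N)%N by apply: leq_trans KN; rewrite leq_maxl.
have Npos : (0 < N)%N by apply: leq_trans KN; lia.
have [n [[f [f0 fN fs fh fv]] dn]] := filter_ex (filterI (HN N NN0 Npos) dB).
have cd : c * d n <= 1 / 4.
  rewrite /c mulrC ler_pdivrMr ?mulr_gt0 //.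
  by have := ler_norm B; have := dn; rewrite /=; lra.
pose rep i j : cayley_point R gen I :=
  if i == 0%N then path_point S [::] u (j%:R / K%:R)
  else if [|| i == N, j == 0%N | j == N] then path_point S [::] u 0 else repr (f i j).
have val0 : val (circuit_path 0) n = mq_proj DC (path_point S [::] u 0).
  by rewrite /= /circuit mulr0.
have repE i j : (i <= N)%N -> (j <= N)%N -> mq_proj DC (rep i j) = f i j.
  move=> iN jN; rewrite /rep; case: eqP => [->|/eqP i0].
    rewrite f0 //= /circuit; congr (mq_proj DC (path_point _ _ _ _)).
    rewrite /N natrM; field; rewrite !pnatr_eq0 -!lt0n L0; lia.
  rewrite -lt0n in i0.
  case: eqP => [->|_] /=; first by rewrite fN // val0.
  case: eqP => [->|_] /=; first by case: (fs i i0 iN) => -> _; rewrite val0.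
  case: eqP => [->|_] /=; first by case: (fs i i0 iN) => _ ->; rewrite val0.
  exact: reprK.
have near_rep i j i' j' : (i <= N)%N -> (j <= N)%N -> (i' <= N)%N -> (j' <= N)%N ->
    mdist (f i j) (f i' j') < c * d n ->
    exists z : int, `|edge_coord e (rep i j) - edge_coord e (rep i' j') + z%:~R| < 1 / 4.
  move=> iN jN i'N j'N; rewrite -!repE // mdist_cayley => /lt_le_trans/(_ cd).
  move=> /(cayley_dist_chain genS)[l l4 /(edge_coord_chain e)[z zl]].
  by exists z; apply: le_lt_trans l4.
have := @circle_grid R (fun i j => edge_coord e (rep i j)) N.
have side0 i : (0 < i)%N -> rep i 0%N = path_point S [::] u 0.
  by move=> i0; rewrite /rep (gtn_eqF i0) orbT.
have sideN i : (0 < i)%N -> rep i N = path_point S [::] u 0.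
  by move=> i0; rewrite /rep (gtn_eqF i0) eqxx !orbT.
have start := edge_coord_start R S e [::] u.
have K0 : K%:R != 0 :> R by rewrite pnatr_eq0; lia.
move=> H; apply/eqP; rewrite -(intr_eq0 R) -(winding_path R S e [::] u K3); apply/eqP.
apply: H.
- by move=> i j _ _; apply: edge_coord_ge0le1.
- by move=> i j iN jN; apply: near_rep => //; [exact: ltnW|exact: fh].
- by move=> i j iN jN; apply: near_rep => //; [exact: ltnW|exact: fv].
- move=> i iN; apply: circle_diff_ends; last by rewrite side0.
  by case: i iN => [|i] iN; [rewrite /rep eqxx mul0r|rewrite side0].
- move=> i iN; apply: circle_diff_ends; last by rewrite sideN.
  case: i iN => [|i] iN; last by rewrite sideN.
  by rewrite /rep eqxx /N natrM mulrAC divff // mul1r path_point_end; left.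
- by move=> j jN; rewrite /rep (gtn_eqF Npos) eqxx /= circle_diffxx.
Qed.

End ConstantPath.

Lemma bounded_not_simply_connected :
  (exists B : R, \forall n \near omega, d n <= B) ->
  ~ simply_connected R (asymptotic_cone ultra o d_gt0).
Proof.
move=> dB sc; apply: (G_not_free genS); apply: closed_word_trivial => e u u1.
exact: circuit_crossing_number.
Qed.

End BoundedScales.

Theorem theorem1p1 (R : realType) :
  [/\ exists f : nat -> nat,
        isoperimetric G_relators f /\ fequiv f (fun n => (n ^ 3)%N),
      exists f : nat -> nat,
        isodiametric G_relators f /\ fequiv f (fun n => n) &
      forall (I : finType) (S : I -> word gen) (genS : generates G_relators S)
             (omega : set_system nat) (ultra : UltraFilter omega)
             (d : nat -> R) (d_gt0 : forall n, 0 < d n),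
        increasing_seq d -> d n @[n --> \oo] --> +oo ->
        ~ simply_connected R
            (asymptotic_cone ultra (fun=> cayley_identity R genS) d_gt0)].
Proof.
split.
- exists (fun n => n * (n * (n + 2)))%N; split; first exact: G_cubic_isoperimetric.
  exists 3%N => n; rewrite !expnS expn0 muln1; split; nia.
- exists (fun n => 10 * n)%N; split; first exact: G_linear_isodiametric.
  by exists 10%N => n; split; lia.
- move=> I S genS omega ultra d d_gt0 d_incr _.
  have d_ge0 n : d 0%N <= d n by rewrite d_incr.
  (* The ultrafilter may be principal, so the scales need not be unbounded along it. *)
  have [B_bound|no_bound] := pselect (exists B : R, omega [set n | d n <= B]).
    exact: bounded_not_simply_connected.
  apply: unbounded_not_simply_connected => // B.
  have [lt|ge] := in_ultra_setVsetC [set n | d n <= B] ultra.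
    by case: no_bound; exists B.
  apply: (@filterS _ omega _ (~` [set n | d n <= B])) => // n /= /negP.
  by rewrite -ltNge => /ltW.
Qed.
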